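(* Assume that every definable subset of $K$ that is closed, bounded and discrete is finite, and take $\tau\in K^\times$ with $|\tau|<|1|$. Let $X\subseteq K^m$ be a definable set having arbitrarily many germs at a given point $p_0\in X$. Let $p,\tau^*\in\mathcal C(X)$ be such that $p_0$ is the unique zero of $p$ and $\tau^*(p_0)=\tau$. Then the ring of integers $(\mathbb Z,+,\times)$ is interpretable in $(\mathcal C(X),\mathcal B)$ with parameters $(p,\tau^* )$.
   Context: Setting. $K$ is a field and $\mathcal O\subseteq K$ is either (ordered case) the unit interval $[-1,1]$ of a total order $\le$ making $K$ an ordered field, or (valued case) the valuation ring of a non-trivial valuation $v$ on $K$. $\mathcal K$ is an expansion of $(K,\mathcal O)$: a structure with universe $K$ in a language extending the ring language $\{0,1,+,-,\times\}$ together with a unary predicate for $\mathcal O$. ''Definable'' means first-order definable with parameters in $\mathcal K$. $\mathcal O^\times$ is the set of non-zero $a\in\mathcal O$ with $a^{-1}\in\mathcal O$; $|x|$ is the class of $x\in K^\times$ in $K^\times/\mathcal O^\times$, $|0|=0$, and $|y|\le|x|$ iff $y\in x\mathcal O$. For $x\in K^m$, $\|x\|=\max_i|x_i|$; $K^m$ carries the topology given by the open balls for $\|\cdot\|$; ''bounded'' is with respect to $\|\cdot\|$. For definable $X\subseteq K^m$, $\mathcal C(X)$ is the ring (pointwise operations) of continuous definable functions $X\to K$; $\mathcal B=\{s\in\mathcal C(X): s(x)\in\mathcal O\ \forall x\in X\}$; $(\mathcal C(X),\mathcal B)$ is the ring expanded by a unary predicate for $\mathcal B$. Germs. Let $p_0\in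 X$ and let $U$ be a definable neighborhood of $p_0$ in $X$. A function $s\in\mathcal C(U)$ vanishes on a germ at $p_0$ if $s(p_0)=0$ and $p_0$ is not an isolated point of the zero set $\{s=0\}$. Functions $s_1,\dots,s_k\in\mathcal C(U)$ vanish on separated germs at $p_0$ if there are $\delta_1,\dots,\delta_k\in\mathcal C(U\setminus\{p_0\})$ such that: (S1) the sets $S_i=\{s_i=0\}\setminus\{p_0\}$ are pairwise disjoint; (S2) each $s_i$ vanishes on a germ at $p_0$; (S3) for $i\ne j$, $\delta_i$ is constantly $1$ on $S_i$ and constantly $0$ on $S_j$; (S4) each $\delta_i$ is bounded on $U\setminus\{p_0\}$. $X$ has arbitrarily many germs at $p_0$ if for every positive integer $k$ there are a definable neighborhood $U$ of $p_0$ in $X$ and $k$ functions in $\mathcal C(U)$ that vanish on separated germs at $p_0$. *)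

(* Defs.v *)
From HB Require Import structures.
From mathcomp Require Import all_boot all_order all_algebra.
From mathcomp Require Import boolp classical_sets functions cardinality.
From mathcomp Require Import ring.

Set Implicit Arguments.
Unset Strict Implicit.
Unset Printing Implicit Defensive.

Import Order.TTheory GRing.Theory Num.Theory.
Local Open Scope classical_set_scope.
Local Open Scope ring_scope.

Record language := Language {
  fsym : Type;
  far : fsym -> nat;
  rsym : Type;
  rar : rsym -> nat }.

Record structure (L : language) (M : Type) := Structure {
  ifun : forall f : fsym L, ('I_(far f) -> M) -> M;
  irel : forall r : rsym L, set ('I_(rar r) -> M) }.

Inductive term (L : language) (V : Type) : Type :=
| Var of V
| App (f : fsym L) of ('I_(far f) -> term L V).

(* The free variables of a formula are indexed by an arbitrary type V; a
   quantifier binds the variable None of its body, so that Some v refers to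
   the outer variable v. *)
Inductive formula (L : language) (V : Type) : Type :=
| FFalse
| FEq of term L V & term L V
| FRel (r : rsym L) of ('I_(rar r) -> term L V)
| FImp of formula L V & formula L V
| FAnd of formula L V & formula L V
| FOr of formula L V & formula L V
| FAll of formula L (option V)
| FEx of formula L (option V).

Definition econs (V M : Type) (a : M) (e : V -> M) : option V -> M :=
  fun o => if o is Some v then e v else a.

Fixpoint teval L M (S : structure L M) (V : Type) (e : V -> M) (t : term L V) : M :=
  match t with
  | Var v => e v
  | App f a => ifun S (fun i => teval S e (a i))
  end.

Fixpoint sat L M (S : structure L M) (V : Type) (phi : formula L V) (e : V -> M)
    : Prop :=
  match phi with
  | FFalse => False
  | FEq t u => teval S e t = teval S e u
  | FRel r a => irel S (fun i => teval S e (a i))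
  | FImp p q => sat S p e -> sat S q e
  | FAnd p q => sat S p e /\ sat S q e
  | FOr p q => sat S p e \/ sat S q e
  | FAll p => forall a, sat S p (econs a e)
  | FEx p => exists a, sat S p (econs a e)
  end.

Definition env_sum (I P M : Type) (x : I -> M) (c : P -> M) : I + P -> M :=
  fun v => match v with inl i => x i | inr p => c p end.

(* A is defined by a formula whose only parameters are the c p, p : P.  The
   index type I of the coordinates is arbitrary: 'I_n for subsets of M^n,
   'I_k * 'I_d for subsets of (M^d)^k, and so on. *)
Definition definable_over L M (S : structure L M) (P : Type) (c : P -> M)
    (I : Type) (A : set (I -> M)) : Prop :=
  exists phi : formula L (I + P), forall x, A x <-> sat S phi (env_sum x c).

Definition definable L M (S : structure L M) (I : Type) (A : set (I -> M))
    : Prop :=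
  definable_over S id A.

(* Interpretation of N in M with parameters c: pi maps the definable set
   D of d-tuples onto N, and the preimages under pi of equality, of the graphs
   of the operations and of the relations of N are definable over c. *)
Definition interpretable L M (SM : structure L M) (P : Type) (c : P -> M)
    L' N (SN : structure L' N) : Prop :=
  exists (d : nat) (D : set ('I_d -> M)) (pi : ('I_d -> M) -> N),
  [/\ definable_over SM c D,
      (forall y : N, exists2 x, D x & pi x = y),
      definable_over SM c [set z : bool * 'I_d -> M |
        [/\ D (fun i => z (false, i)), D (fun i => z (true, i)) &
            pi (fun i => z (false, i)) = pi (fun i => z (true, i))]],
      (forall f : fsym L',
        definable_over SM c [set z : option 'I_(far f) * 'I_d -> M |
          (forall j, D (fun i => z (j, i))) /\
          pi (fun i => z (None, i)) =
            ifun SN (fun j => pi (fun i => z (Some j, i)))]) &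
      (forall r : rsym L',
        definable_over SM c [set z : 'I_(rar r) * 'I_d -> M |
          (forall j, D (fun i => z (j, i))) /\
          irel SN (fun j => pi (fun i => z (j, i)))])].

Definition lang_sum (L1 L2 : language) : language :=
  @Language (fsym L1 + fsym L2)
    (fun f => match f with inl g => far g | inr g => far g end)
    (rsym L1 + rsym L2)
    (fun r => match r with inl q => rar q | inr q => rar q end).

Definition structure_sum L1 L2 M (S1 : structure L1 M) (S2 : structure L2 M)
    : structure (lang_sum L1 L2) M :=
  @Structure (lang_sum L1 L2) M
    (fun f => match f return
         ('I_(@far (lang_sum L1 L2) f) -> M) -> M with
       inl g => @ifun _ _ S1 g | inr g => @ifun _ _ S2 g end)
    (fun r => match r return
         set ('I_(@rar (lang_sum L1 L2) r) -> M) with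
       inl q => @irel _ _ S1 q | inr q => @irel _ _ S2 q end).

Inductive ring_fsym := RZero | ROne | RAdd | ROpp | RMul.

Definition ring_far (f : ring_fsym) : nat :=
  match f with RZero | ROne => 0 | ROpp => 1 | RAdd | RMul => 2 end.

Definition ring_pred_lang : language :=
  @Language ring_fsym ring_far unit (fun=> 1%N).

Definition ring_pred_structure (R : pzRingType) (P : set R)
    : structure ring_pred_lang R :=
  @Structure ring_pred_lang R
    (fun f => match f return ('I_(ring_far f) -> R) -> R with
       | RZero => fun=> 0
       | ROne => fun=> 1
       | RAdd => fun a => a ord0 + a ord_max
       | ROpp => fun a => - a ord0
       | RMul => fun a => a ord0 * a ord_max
       end)
    (fun _ => [set a | P (a ord0)]).

Inductive arith_fsym := ZAdd | ZMul.

Definition arith_lang : language :=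
  @Language arith_fsym (fun=> 2%N) void (fun=> 0%N).

Definition int_structure : structure arith_lang int :=
  @Structure arith_lang int
    (fun f => match f return ('I_2 -> int) -> int with
       | ZAdd => fun a => a ord0 + a ord_max
       | ZMul => fun a => a ord0 * a ord_max
       end)
    (fun r => match r with end).

Record field_order (K : fieldType) (le : rel K) : Prop := FieldOrder {
  fo_anti : antisymmetric le;
  fo_trans : transitive le;
  fo_total : total le;
  fo_add : forall x y z, le x y -> le (x + z) (y + z);
  fo_mul : forall x y, le 0 x -> le 0 y -> le 0 (x * y) }.

Definition is_unit_interval (K : fieldType) (O : set K) : Prop :=
  exists2 le : rel K, field_order le & O = [set x | le (-1) x /\ le x 1].

Record group_order (G : zmodType) (le : rel G) : Prop := GroupOrder {
  go_anti : antisymmetric le;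
  go_trans : transitive le;
  go_total : total le;
  go_add : forall x y z, le x y -> le (x + z) (y + z) }.

(* Only the values of v on K^* matter; v 0 stands for the value at infinity. *)
Record nontrivial_valuation (K : fieldType) (G : zmodType) (le : rel G)
    (v : K -> G) : Prop := NontrivialValuation {
  val_mul : forall x y, x != 0 -> y != 0 -> v (x * y) = v x + v y;
  val_add : forall x y, x != 0 -> y != 0 -> x + y != 0 ->
    le (v x) (v (x + y)) \/ le (v y) (v (x + y));
  val_nontrivial : exists2 x, x != 0 & v x != 0 }.

Definition is_valuation_ring (K : fieldType) (O : set K) : Prop :=
  exists (G : zmodType) (le : rel G) (v : K -> G),
  [/\ group_order le, nontrivial_valuation le v &
      O = [set x | x = 0 \/ le 0 (v x)]].

Record ovfield := OVField {
  ovfield_sort :> fieldType;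
  ovring : set ovfield_sort;
  ovringP : is_unit_interval ovring \/ is_valuation_ring ovring }.

(* absle y x and abslt y x stand for |y| <= |x| and |y| < |x| in K^*/O^* with
   |0| added as least element. *)
Definition absle (K : ovfield) (y x : K) : Prop :=
  exists2 a, ovring a & y = x * a.

Definition abslt (K : ovfield) (y x : K) : Prop := absle y x /\ ~ absle x y.

(* Open ball of K^m of centre a and radius |r|; ||x - a|| < |r| is expressed on
   coordinates, and r is always taken nonzero. *)
Definition oball (K : ovfield) m (a : 'I_m -> K) (r : K) : set ('I_m -> K) :=
  [set x | forall i, abslt (x i - a i) r].

Definition closed_in_field (K : ovfield) (A : set K) : Prop :=
  forall a, ~ A a ->
    exists2 r, r != 0 & forall x, abslt (x - a) r -> ~ A x.

Definition bounded_in_field (K : ovfield) (A : set K) : Prop :=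
  exists r, forall x, A x -> absle x r.

Definition discrete_in_field (K : ovfield) (A : set K) : Prop :=
  forall a, A a ->
    exists2 r, r != 0 & forall x, A x -> abslt (x - a) r -> x = a.

Definition continuous_on (K : ovfield) m (X : set ('I_m -> K)) (f : X -> K)
    : Prop :=
  forall (a : X) (e : K), e != 0 ->
    exists2 r : K, r != 0 &
      forall x : X, oball (val a) r (val x) -> abslt (f x - f a) e.

(* The coordinate None of a point of the graph carries the value. *)
Definition graph (K : ovfield) m (X : set ('I_m -> K)) (f : X -> K)
    : set (option 'I_m -> K) :=
  [set z | exists2 x : X, val x = (fun i => z (Some i)) & f x = z None].

Definition expansion (K : ovfield) L (S : structure L K)
    : structure (lang_sum ring_pred_lang L) K :=
  structure_sum (ring_pred_structure (@ovring K)) S.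

Record defset (K : ovfield) L (S : structure L K) (m : nat) := DefSet {
  defset_set :> set ('I_m -> K);
  defsetP : definable (expansion S) defset_set }.

Definition contdef (K : ovfield) L (S : structure L K) m
    (X : set ('I_m -> K)) (f : X -> K) : Prop :=
  continuous_on f /\ definable (expansion S) (graph f).

Section Definability.
Variables (K : ovfield) (L : language) (S : structure L K).
Local Notation E := (expansion S).
Local Notation LL := (lang_sum ring_pred_lang L).

Fixpoint trename V W (h : V -> W) (t : term LL V) : term LL W :=
  match t with
  | Var v => Var _ (h v)
  | App f a => App (fun i => trename h (a i))
  end.

Fixpoint frename V W (h : V -> W) (phi : formula LL V) : formula LL W :=
  match phi with
  | FFalse => FFalse _ _
  | FEq t u => FEq (trename h t) (trename h u)
  | FRel r a => FRel (fun i => trename h (a i))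
  | FImp p q => FImp (frename h p) (frename h q)
  | FAnd p q => FAnd (frename h p) (frename h q)
  | FOr p q => FOr (frename h p) (frename h q)
  | FAll p => FAll (frename (omap h) p)
  | FEx p => FEx (frename (omap h) p)
  end.

Lemma teval_rename V W (h : V -> W) (e : W -> K) t :
  teval E e (trename h t) = teval E (e \o h) t.
Proof.
elim: t => [v|f a IH] //=.
suff -> : (fun i => teval E e (trename h (a i))) =
          (fun i => teval E (e \o h) (a i)) by [].
by apply/funext => i; exact: IH.
Qed.

Lemma econs_omap V W (h : V -> W) (e : W -> K) a :
  econs a e \o omap h = econs a (e \o h).
Proof. by apply/funext => -[]. Qed.

Lemma sat_rename V (phi : formula LL V) : forall W (h : V -> W) (e : W -> K),
  sat E (frename h phi) e <-> sat E phi (e \o h).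
Proof.
elim: phi => {V}.
- by [].
- by move=> V t u W h e /=; rewrite !teval_rename.
- move=> V r a W h e /=.
  suff -> : (fun i => teval E e (trename h (a i))) =
            (fun i => teval E (e \o h) (a i)) by [].
  by apply/funext => i; rewrite teval_rename.
- by move=> V p IHp q IHq W h e /=; have := IHp _ h e; have := IHq _ h e; tauto.
- by move=> V p IHp q IHq W h e /=; have := IHp _ h e; have := IHq _ h e; tauto.
- by move=> V p IHp q IHq W h e /=; have := IHp _ h e; have := IHq _ h e; tauto.
- move=> V p IHp W h e /=; split => H a.
    by move: (H a) => /IHp; rewrite econs_omap.
  by apply/IHp; rewrite econs_omap.
- move=> V p IHp W h e /=; split => -[a Ha]; exists a.
    by move: Ha => /IHp; rewrite econs_omap.
  by apply/IHp; rewrite econs_omap.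
Qed.

Lemma definable_reindex I J (h : I -> J) (A : set (I -> K)) :
  definable E A -> definable E [set x : J -> K | A (x \o h)].
Proof.
move=> [phi Hphi].
exists (frename (fun v => match v with inl i => inl (h i) | inr p => inr p end)
  phi) => x.
rewrite sat_rename /= Hphi.
suff -> : env_sum (x \o h) id = env_sum x id \o
  (fun v => match v with inl i => inl (h i) | inr p => inr p end) by [].
by apply/funext => -[].
Qed.

Lemma definable_and I (A B : set (I -> K)) :
  definable E A -> definable E B -> definable E [set x | A x /\ B x].
Proof.
by move=> [p Hp] [q Hq]; exists (FAnd p q) => x /=; rewrite Hp Hq.
Qed.

Lemma definable_ex I (A : set (option I -> K)) :
  definable E A -> definable E [set x | exists a, A (econs a x)].
Proof.
move=> [p Hp].
pose h (v : option I + K) : option (I + K) :=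
  match v with inl (Some i) => Some (inl i) | inl None => None
             | inr c => Some (inr c) end.
exists (FEx (frename h p)) => x /=.
have K1 a : sat E (frename h p) (econs a (env_sum x id)) <-> A (econs a x).
  rewrite sat_rename Hp.
  suff -> : econs a (env_sum x id) \o h = env_sum (econs a x) id by [].
  by apply/funext => -[[i|]|c].
by split=> -[a Ha]; exists a; apply/K1.
Qed.

Lemma definable_ext I (A B : set (I -> K)) :
  definable E A -> (forall x, A x <-> B x) -> definable E B.
Proof. by move=> [p Hp] AB; exists p => x; rewrite -AB. Qed.

Lemma definable_const I (i : I) (c : K) : definable E [set x | x i = c].
Proof. by exists (FEq (Var _ (inl i)) (Var _ (inr c))) => x. Qed.

Let rsymb (f : ring_fsym) : fsym LL := inl f.

Lemma definable_sub I (i j k : I) : definable E [set x | x i = x j - x k].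
Proof.
exists (FEq (Var _ (inl i)) (@App LL _ (rsymb RAdd) (fun o : 'I_2 =>
  if o == ord0 then Var _ (inl j) else
  @App LL _ (rsymb ROpp) (fun _ : 'I_1 => Var _ (inl k))))) => x.
by [].
Qed.

Lemma definable_mul I (i j k : I) : definable E [set x | x i = x j * x k].
Proof.
exists (FEq (Var _ (inl i)) (@App LL _ (rsymb RMul) (fun o : 'I_2 =>
  if o == ord0 then Var _ (inl j) else Var _ (inl k)))) => x.
by [].
Qed.

Lemma graph_op m (X : set ('I_m -> K)) (op : K -> K -> K) (f g : X -> K) :
  (forall I (i j k : I), definable E [set x | x i = op (x j) (x k)]) ->
  definable E (graph f) -> definable E (graph g) ->
  definable E (graph (fun x => op (f x) (g x))).
Proof.
move=> Hop Hf Hg.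
pose hf (o : option 'I_m) : option (option (option 'I_m)) :=
  if o is Some i then Some (Some (Some i)) else None.
pose hg (o : option 'I_m) : option (option (option 'I_m)) :=
  if o is Some i then Some (Some (Some i)) else Some None.
have D1 := definable_reindex hf Hf.
have D2 := definable_reindex hg Hg.
have D3 := Hop _ (Some (Some None) : option (option (option 'I_m))) None
  (Some None).
apply: (definable_ext (definable_ex (definable_ex
  (definable_and (definable_and D1 D2) D3)))) => z /=; split.
  move=> [b [a [[[x xE fx] [y yE gy]] zE]]].
  exists x; first exact: xE.
  have xy : x = y by apply/val_inj; rewrite xE yE.
  by rewrite fx xy gy; exact: esym zE.
move=> [x xE zE]; exists (g x), (f x); split=> //.
by split; exists x.
Qed.

Lemma graph_one m (X : set ('I_m -> K)) :
  definable E X -> definable E (graph (fun _ : X => 1)).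
Proof.
move=> HX.
apply: (definable_ext (definable_and (definable_reindex Some HX)
  (definable_const None 1))) => z /=; split.
  move=> [Xz z1]; exists (SigSub (mem_set Xz)) => //.
by move=> [x xE z1]; split=> //; rewrite /comp -xE; exact: set_valP.
Qed.

End Definability.

Section Continuity.
Variable K : ovfield.
Local Notation O := (@ovring K).
Implicit Types x y z e r : K.

Let small z := O z /\ ~ (z != 0 /\ O z^-1).

Let le_facts (le : rel K) : field_order le ->
  [/\ reflexive le, le 0 1,
      (forall x y z t, le x y -> le z t -> le (x + z) (y + t)),
      (forall x, le 0 x = le (- x) 0) &
      (forall x y, le 0 x -> le y 0 -> le (x * y) 0)].
Proof.
move=> fo.
have R : reflexive le by move=> x; have := fo_total fo x x; rewrite orbb.
have add := fo_add fo.
have N x : le 0 x = le (- x) 0.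
  apply/idP/idP => [/(add _ _ (- x))|/(add _ _ x)].
    by rewrite add0r subrr.
  by rewrite addNr add0r.
split=> //.
- have /orP[//|h] := fo_total fo 0 1.
  have h' : le 0 (-1) by rewrite N opprK.
  by have := fo_mul fo h' h'; rewrite mulrNN mulr1.
- move=> x y z t xy zt; apply: (fo_trans fo (add _ _ z xy)).
  by rewrite ![y + _]addrC; apply: add.
- move=> x y x0 y0; have h : le 0 (- y) by rewrite N opprK.
  by have := fo_mul fo x0 h; rewrite mulrN N opprK.
Qed.

Let ov_facts : [/\ O 0, O 1,
  (forall x y, O x -> O y -> O (x * y)),
  (forall x, x != 0 -> O x \/ O x^-1) &
  exists2 h, h != 0 & forall x y, small x -> small y -> small (h * (x - y))].
Proof.
have [[le fo OE]|[G [le [v [go nv OE]]]]] := ovringP K.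
  have [R le01 leD leN0 lepn] := le_facts fo.
  have T := fo_trans fo.
  have leB x y : le x y = le 0 (y - x).
    apply/idP/idP => [/(fo_add fo (- x))|/(fo_add fo x)].
      by rewrite subrr.
    by rewrite add0r subrK.
  have leN x y : le x y = le (- y) (- x) by rewrite leB [RHS]leB opprK addrC.
  have OP x : O x = (le (-1) x /\ le x 1) by rewrite OE.
  have ON x : O x -> O (- x).
    by rewrite !OP => -[h1 h2]; split; rewrite leN ?opprK.
  have O1 : O 1.
    rewrite OP; split=> //; apply: (T 0) => //; by rewrite -leN0.
  have Opos x : le 0 x -> O x = le x 1.
    move=> x0; apply/propext; rewrite OP; split=> [[]//|x1]; split=> //.
    by apply: (T 0) => //; rewrite -leN0.
  have mul1 x y : le 0 x -> le x 1 -> le 0 y -> le y 1 -> le (x * y) 1.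
    move=> x0 x1 y0 y1; apply: (T x) => //.
    by rewrite leB -{1}[x]mulr1 -mulrBr; apply: (fo_mul fo) => //; rewrite -leB.
  have sgn x : le 0 x \/ le 0 (- x).
    have /orP[|h] := fo_total fo 0 x; first by left.
    by right; rewrite leN0 opprK.
  have OM x y : O x -> O y -> O (x * y).
    have pp a b : le 0 a -> le 0 b -> O a -> O b -> O (a * b).
      move=> a0 b0; rewrite (Opos _ a0) (Opos _ b0) => a1 b1.
      by rewrite (Opos _ (fo_mul fo a0 b0)); apply: mul1.
    move=> Ox Oy; case: (sgn x) => sx; case: (sgn y) => sy.
    - exact: pp.
    - by rewrite -[_ * _]opprK -mulrN; apply/ON/pp => //; apply: ON.
    - by rewrite -[_ * _]opprK -mulNr; apply/ON/pp => //; apply: ON.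
    - by rewrite -mulrNN; apply: pp => //; apply: ON.
  have inv_pos x : x != 0 -> le 0 x -> le 0 x^-1.
    move=> x0 px; case: (sgn x^-1) => // h.
    have : le 0 (-1) by have := fo_mul fo px h; rewrite mulrN divff.
    rewrite leN0 opprK => h1.
    have e : (1 : K) = 0 by apply: (fo_anti fo); rewrite h1 le01.
    by move: (oner_neq0 K); rewrite e eqxx.
  have inv_pos1 x : x != 0 -> le 0 x -> le 1 x -> O x^-1.
    move=> x0 px x1; rewrite (Opos _ (inv_pos _ x0 px)) leB.
    have h : le 0 (x - 1) by rewrite -leB.
    by have := fo_mul fo (inv_pos _ x0 px) h; rewrite mulrBr mulVf // mulr1.
  have Otot x : x != 0 -> O x \/ O x^-1.
    have pos y : y != 0 -> le 0 y -> O y \/ O y^-1.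
      move=> y0 py; have /orP[y1|y1] := fo_total fo y 1.
        by left; rewrite (Opos _ py).
      by right; exact: inv_pos1.
    move=> x0; case: (sgn x) => sx; first exact: pos.
    have xN : - x != 0 by rewrite oppr_eq0.
    case: (pos _ xN sx) => [/ON|]; first by rewrite opprK; left.
    by rewrite invrN => /ON; rewrite opprK; right.
  have O0 : O 0 by rewrite Opos.
  pose two : K := 1 + 1.
  have p2 : le 0 two by rewrite /two -[0]addr0; apply: leD.
  have le12 : le 1 two by rewrite /two -{1}[1]add0r; apply: (fo_add fo).
  have n2 : two != 0.
    apply/eqP => e; move: le12; rewrite e => l10.
    have e1 : (1 : K) = 0 by apply: (fo_anti fo); rewrite l10 le01.
    by move: (oner_neq0 K); rewrite e1 eqxx.
  have smP z : small z <-> [/\ le (-1) z, le z 1, z != 1 & z != -1].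
    split.
      rewrite /small OP => -[[z1 z2] nz]; split=> //; apply/eqP => zE; apply: nz.
        by rewrite zE invr1 oner_neq0.
      by rewrite zE invrN1 oppr_eq0 oner_neq0; split=> //; apply: ON.
    move=> [z1 z2 z3 z4]; split; first by rewrite OP.
    rewrite OP => -[z0 [i1 i2]].
    case: (sgn z) => sz.
      have : le z 1 && le 1 z.
        rewrite z2 /= leB.
        have h : le 0 (1 - z^-1) by rewrite -leB.
        by have := fo_mul fo sz h; rewrite mulrBr mulr1 divff.
      by move=> /(fo_anti fo) zE; rewrite zE eqxx in z3.
    have : le z (-1) && le (-1) z.
      rewrite z1 andbT leB.
      have h : le 0 (1 + z^-1) by move: i1; rewrite leB opprK addrC.
      by have := fo_mul fo sz h; rewrite mulrDr mulr1 mulNr divff // addrC.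
    by move=> /(fo_anti fo) zE; rewrite zE eqxx in z4.
  split=> //; exists two^-1; first by rewrite invr_eq0.
  move=> x y /smP[x1 x2 x3 x4] /smP[y1 y2 y3 y4].
  set w := two^-1 * (x - y).
  have wE : w + w = x - y.
    have two1 : two^-1 + two^-1 = 1.
      by rewrite -{1 2}[two^-1]mulr1 -mulrDr mulVf.
    by rewrite /w -mulrDl two1 mul1r.
  have half a b : le (a + a) (b + b) -> le a b.
    move=> h; have /orP[//|ba] := fo_total fo a b.
    have e : a + a = b + b by apply: (fo_anti fo); rewrite h leD.
    have -> : a = b by apply: (mulfI n2); rewrite !mulrDl !mul1r.
    exact: R.
  have ub a b : le a 1 -> le b 1 -> a != 1 -> a + b != 1 + 1.
    move=> a1 b1 na; apply/eqP => e; move: na; apply/negP; rewrite negbK.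
    apply/eqP; apply: (fo_anti fo); rewrite a1 /=.
    have -> : le 1 a = le b 1.
      by rewrite leB [RHS]leB -{1}[a](addrK b) e addrAC addrK.
    exact: b1.
  apply/smP; split.
  - apply: half; rewrite wE; apply: leD => //; by rewrite -leN.
  - apply: half; rewrite wE; apply: leD => //; by rewrite leN opprK.
  - apply/eqP => w1; move: wE; rewrite w1 => /esym/eqP; apply/negP.
    by apply: ub => //; rewrite leN opprK.
  - apply/eqP => w1; move: wE; rewrite w1 => /esym/eqP; apply/negP.
    rewrite -eqr_opp !opprD !opprK.
    apply: ub => //; first by rewrite leN opprK.
    by rewrite eqr_oppLR.
have OP x : O x <-> x = 0 \/ le 0 (v x) by rewrite OE.
have R : reflexive le by move=> x; have := go_total go x x; rewrite orbb.
have v1 : v 1 = 0.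
  apply: (addrI (v 1)); rewrite addr0 -(val_mul nv) ?oner_neq0 //.
  by rewrite mulr1.
have leN (x : G) : le 0 x = le (- x) 0.
  apply/idP/idP => [/(go_add go (- x))|/(go_add go x)].
    by rewrite add0r subrr.
  by rewrite addNr add0r.
have vV x : x != 0 -> v x^-1 = - v x.
  move=> x0; apply: (addrI (v x)).
  by rewrite -(val_mul nv) ?invr_eq0 // divff // subrr.
have gdbl (x : G) : x + x = 0 -> x = 0.
  have pos (y : G) : le 0 y -> y + y = 0 -> y = 0.
    move=> y0 yy; apply: (go_anti go); rewrite y0 andbT.
    by have := go_add go y y0; rewrite yy add0r.
  move=> xx; have /orP[h|h] := go_total go 0 x; first exact: pos.
  apply: oppr_inj; rewrite oppr0; apply: pos; first by rewrite leN opprK.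
  by rewrite -opprD xx oppr0.
have vN x : x != 0 -> v (- x) = v x.
  move=> x0.
  have vm1 : v (-1) = 0.
    by apply: gdbl; rewrite -(val_mul nv) ?oppr_eq0 ?oner_neq0 // mulrNN mulr1.
  by rewrite -mulN1r (val_mul nv) ?oppr_eq0 ?oner_neq0 // vm1 add0r.
have smP z : small z <-> z = 0 \/ (le 0 (v z) /\ v z <> 0).
  split.
    move=> [/OP[->|zO] nz]; first by left.
    have [->|z0] := eqVneq z 0; first by left.
    right; split=> // vz; apply: nz; split=> //; apply/OP; right.
    by rewrite vV // vz oppr0.
  move=> [->|[zO vz]].
    by split; [apply/OP; left|rewrite eqxx => -[]].
  split; first by apply/OP; right.
  move=> [z0 /OP[/eqP|]]; first by rewrite invr_eq0 (negbTE z0).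
  rewrite vV // => h; apply: vz; apply: (go_anti go); rewrite zO andbT.
  by move: h; rewrite leN opprK.
split.
- by apply/OP; left.
- by apply/OP; right; rewrite v1.
- move=> x y Ox Oy; apply/OP.
  have [->|x0] := eqVneq x 0; first by left; rewrite mul0r.
  have [->|y0] := eqVneq y 0; first by left; rewrite mulr0.
  right; rewrite (val_mul nv) //.
  move: Ox Oy => /OP[/eqP|hx]; first by rewrite (negbTE x0).
  move=> /OP[/eqP|hy]; first by rewrite (negbTE y0).
  apply: (go_trans go hy).
  by have := go_add go (v y) hx; rewrite add0r.
- move=> x x0; have /orP[h|h] := go_total go 0 (v x).
    by left; apply/OP; right.
  by right; apply/OP; right; rewrite vV // leN opprK.
- exists 1; first exact: oner_neq0.
  move=> x y; rewrite mul1r => sx sy.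
  have [->|xy0] := eqVneq (x - y) 0; first by apply/smP; left.
  have [x0|x0] := eqVneq x 0.
    have [y0|y0] := eqVneq y 0; first by rewrite x0 y0 subrr eqxx in xy0.
    rewrite x0 sub0r; move/smP: sy => [/eqP|[h1 h2]].
      by rewrite (negbTE y0).
    by apply/smP; right; rewrite vN.
  have [y0|y0] := eqVneq y 0; first by rewrite y0 subr0.
  have yN : - y != 0 by rewrite oppr_eq0.
  move/smP: sx => [/eqP|[hx1 hx2]]; first by rewrite (negbTE x0).
  move/smP: sy => [/eqP|[hy1 hy2]]; first by rewrite (negbTE y0).
  apply/smP; right.
  have gt (a b : G) : le 0 a -> a <> 0 -> le a b -> le 0 b /\ b <> 0.
    move=> a0 an ab; split; first exact: (go_trans go a0).
    by move=> b0; apply: an; apply: (go_anti go); rewrite -{1}b0 ab.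
  case: (val_add nv x0 yN xy0) => [|]; first exact: gt.
  by rewrite vN //; exact: gt.
Qed.

Let abslt_small e x : e != 0 -> abslt x e <-> small (x / e).
Proof.
move=> e0; split.
  move=> [[a Oa xE] nle]; split; first by rewrite xE mulrAC divff // mul1r.
  move=> [xe0 Oi]; apply: nle; exists (x / e)^-1 => //.
  by rewrite invf_div mulrCA divff ?mulr1 //; apply: contra_neq xe0 => ->;
     rewrite mul0r.
move=> [Ox nO]; split; first by exists (x / e) => //; rewrite mulrCA divff ?mulr1.
move=> [a Oa eE]; apply: nO.
have x0 : x != 0 by apply: contra_neq e0; rewrite eE => ->; rewrite mul0r.
split; first by rewrite mulf_neq0 // invr_eq0.
by rewrite invf_div eE mulrAC divff // mul1r.
Qed.

Let small0 : small 0.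
Proof. by have [O0 _ _ _ _] := ov_facts; split=> //; rewrite eqxx => -[]. Qed.

Let smallMO a x : O a -> small x -> small (a * x).
Proof.
have [O0 O1 OM _ _] := ov_facts => Oa [Ox nx]; split; first exact: OM.
move=> [ax0 Oi]; apply: nx.
have x0 : x != 0 by apply: contra_neq ax0 => ->; rewrite mulr0.
have a0 : a != 0 by apply: contra_neq ax0 => ->; rewrite mul0r.
split=> //; have := OM _ _ Oa Oi.
by rewrite invfM mulrA divff // mul1r.
Qed.

Lemma abslt0 e : e != 0 -> abslt 0 e.
Proof. by move=> e0; apply/(abslt_small _ e0); rewrite mul0r; exact: small0. Qed.

Lemma abslt_sub e : e != 0 -> exists2 r, r != 0 &
  forall x y, abslt x r -> abslt y r -> abslt (x - y) e.
Proof.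
move=> e0; have [_ _ _ _ [h h0 H]] := ov_facts.
have he : h * e != 0 by rewrite mulf_neq0.
exists (h * e) => // x y /(abslt_small _ he) sx /(abslt_small _ he) sy.
apply/(abslt_small _ e0); have := H _ _ sx sy.
by rewrite -mulrBl invfM mulrCA mulVKf.
Qed.

Lemma abslt_mulc c e : e != 0 -> exists2 r, r != 0 &
  forall x, abslt x r -> abslt (c * x) e.
Proof.
move=> e0; have [c0|c0] := eqVneq c 0.
  by exists 1; [exact: oner_neq0|move=> x _; rewrite c0 mul0r; exact: abslt0].
have ec : e / c != 0 by rewrite mulf_neq0 // invr_eq0.
exists (e / c) => // x /(abslt_small _ ec).
by rewrite invf_div mulrA => h; apply/(abslt_small _ e0); rewrite (mulrC c).
Qed.

Lemma abslt_mul e x y : e != 0 -> abslt x 1 -> abslt y e -> abslt (x * y) e.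
Proof.
move=> e0 /(abslt_small _ (oner_neq0 K)); rewrite divr1 => -[Ox _].
move=> /(abslt_small _ e0) sy; apply/(abslt_small _ e0).
by rewrite -mulrA; exact: smallMO.
Qed.

Lemma abslt_min r s : r != 0 -> s != 0 -> exists2 t, t != 0 &
  forall x, abslt x t -> abslt x r /\ abslt x s.
Proof.
have [_ _ _ tot _] := ov_facts.
have key a b : a != 0 -> b != 0 -> O (a / b) ->
    forall x, abslt x a -> abslt x b.
  move=> a0 b0 Oab x /(abslt_small _ a0) sx; apply/(abslt_small _ b0).
  have := smallMO Oab sx.
  by rewrite mulrC mulrA mulfVK.
move=> r0 s0; case: (tot (r / s)) => [|h|].
- by rewrite mulf_neq0 // invr_eq0.
- by exists r => // x xr; split=> //; apply: key xr.
- by rewrite invf_div => h; exists s => // x xs; split=> //; apply: key xs.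
Qed.

End Continuity.

Section ContinuityOps.
Variables (K : ovfield) (m : nat) (X : set ('I_m -> K)).

Lemma continuous_one : continuous_on (fun _ : X => 1).
Proof.
move=> a e e0; exists 1; first exact: oner_neq0.
by move=> x _; rewrite subrr; exact: abslt0.
Qed.

Lemma continuous_op (op : K -> K -> K) (f g : X -> K) :
  (forall b c e : K, e != 0 -> exists2 r, r != 0 &
    forall y z, abslt (y - b) r -> abslt (z - c) r ->
      abslt (op y z - op b c) e) ->
  continuous_on f -> continuous_on g ->
  continuous_on (fun x => op (f x) (g x)).
Proof.
move=> Hop Hf Hg a e e0.
have [r r0 H] := Hop (f a) (g a) _ e0.
have [s s0 Hs] := Hf a _ r0; have [t t0 Ht] := Hg a _ r0.
have [u u0 Hu] := abslt_min s0 t0.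
exists u => // x xu.
by apply: H; [apply: Hs|apply: Ht] => i; have [] := Hu _ (xu i).
Qed.

Lemma op_sub (b c e : K) : e != 0 -> exists2 r, r != 0 &
  forall y z, abslt (y - b) r -> abslt (z - c) r ->
    abslt ((y - z) - (b - c)) e.
Proof.
move=> e0; have [r r0 H] := abslt_sub e0; exists r => // y z hy hz.
have -> : y - z - (b - c) = y - b - (z - c) by ring.
exact: H.
Qed.

Lemma abslt_add (e : K) : e != 0 -> exists2 r, r != 0 &
  forall x y : K, abslt x r -> abslt y r -> abslt (x + y) e.
Proof.
move=> e0; have [r r0 H] := abslt_sub e0; have [s s0 H'] := abslt_sub r0.
have [t t0 Ht] := abslt_min r0 s0.
exists t => // x y /Ht[xr _] /Ht[_ ys].
have := H _ _ xr (H' _ _ (abslt0 s0) ys).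
by rewrite sub0r opprK.
Qed.

Lemma op_mul (b c e : K) : e != 0 -> exists2 r, r != 0 &
  forall y z, abslt (y - b) r -> abslt (z - c) r -> abslt (y * z - b * c) e.
Proof.
move=> e0.
have [r r0 Hr] := abslt_add e0; have [s s0 Hs] := abslt_add r0.
have [t1 t10 H1] := abslt_mulc c r0; have [t2 t20 H2] := abslt_mulc b s0.
have [u1 u10 Hu1] := abslt_min t10 (oner_neq0 K).
have [u2 u20 Hu2] := abslt_min t20 s0.
have [u u0 Hu] := abslt_min u10 u20.
exists u => // y z /Hu[/Hu1[y1 y2] _] /Hu[_ /Hu2[z1 z2]].
have -> : y * z - b * c = c * (y - b) + (b * (z - c) + (y - b) * (z - c))
  by ring.
apply: Hr; first exact: H1.
by apply: Hs; [exact: H2|exact: abslt_mul].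
Qed.

End ContinuityOps.

Section Ring.
Variables (K : ovfield) (L : language) (S : structure L K) (m : nat).
Variable X : defset S m.

Definition contdef_pred : {pred X -> K} := fun f => `[< contdef S f >].

Lemma contdef_subring : subring_closed contdef_pred.
Proof.
split=> [|f g /asboolP[cf df] /asboolP[cg dg]
         |f g /asboolP[cf df] /asboolP[cg dg]]; apply/asboolP; split.
- exact: continuous_one.
- by apply: graph_one; exact: defsetP.
- exact: (continuous_op (@op_sub K)).
- by apply: (graph_op (op := fun x y => x - y)) => // I i j k;
    exact: definable_sub.
- exact: (continuous_op (@op_mul K)).
- by apply: (graph_op (op := fun x y => x * y)) => // I i j k;
    exact: definable_mul.
Qed.

HB.instance Definition _ :=
  GRing.isSubringClosed.Build (X -> K) contdef_pred contdef_subring.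

(* The ring C(X), with operations inherited from the ring of all functions
   X -> K, hence pointwise. *)
Record contring := ContRing {
  contring_fun :> X -> K;
  contring_mem : contring_fun \in contdef_pred }.

HB.instance Definition _ := [isSub for contring_fun].
HB.instance Definition _ := [Choice of contring by <:].
HB.instance Definition _ :=
  GRing.SubChoice_isSubComPzRing.Build (X -> K) contdef_pred contring
    contdef_subring.

Definition ovalued : set contring := [set s | forall x, ovring (s x)].

End Ring.

Section Germs.
Variables (K : ovfield) (L : language) (S : structure L K) (m : nat).

Definition zeroset (U : set ('I_m -> K)) (s : U -> K) : set ('I_m -> K) :=
  [set z | exists2 x : U, val x = z & s x = 0].

Definition isolated_point (Z : set ('I_m -> K)) (z : 'I_m -> K) : Prop :=
  Z z /\ exists2 r : K, r != 0 & Z `&` oball z r = [set z].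

Definition vanishes_on_germ (p0 : 'I_m -> K) (U : set ('I_m -> K))
    (s : U -> K) : Prop :=
  zeroset s p0 /\ ~ isolated_point (zeroset s) p0.

Definition vanish_on_separated_germs (p0 : 'I_m -> K) (U : set ('I_m -> K))
    (k : nat) (s : 'I_k -> U -> K) : Prop :=
  let Z i := zeroset (s i) `\ p0 in
  exists delta : 'I_k -> (U `\ p0) -> K,
  [/\ (forall i, contdef S (delta i)),
      (forall i j, i != j -> Z i `&` Z j = set0),
      (forall i, vanishes_on_germ p0 (s i)),
      (forall i j, i != j -> forall x : U `\ p0,
        (Z i (val x) -> delta i x = 1) /\ (Z j (val x) -> delta i x = 0)) &
      (forall i, bounded_in_field (range (delta i)))].

Definition definable_nbhd (X : set ('I_m -> K)) (p0 : 'I_m -> K)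
    (U : set ('I_m -> K)) : Prop :=
  [/\ definable (expansion S) U, U `<=` X, U p0 &
      exists2 r : K, r != 0 & X `&` oball p0 r `<=` U].

Definition arbitrarily_many_germs (X : set ('I_m -> K)) (p0 : 'I_m -> K)
    : Prop :=
  forall k : nat, (0 < k)%N ->
  exists (U : set ('I_m -> K)) (s : 'I_k -> U -> K),
  [/\ definable_nbhd X p0 U, (forall i, contdef S (s i)) &
      vanish_on_separated_germs p0 s].

End Germs.

(* Subsets of K are seen as sets of maps 'I_1 -> K for definability. *)
Definition definable_in_field (K : ovfield) L (S : structure L K) (A : set K)
    : Prop :=
  definable (expansion S) [set x : 'I_1 -> K | A (x ord0)].

Definition contring_structure (K : ovfield) L (S : structure L K) m
    (X : defset S m) : structure ring_pred_lang (contring X) :=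
  ring_pred_structure (@ovalued K L S m X).

(* Main.v *)
Require Import Defs.
From mathcomp Require Import all_boot all_order all_algebra.
From mathcomp Require Import boolp classical_sets functions cardinality.
From HB Require Import structures.
From mathcomp Require Import ring lra zify.
Import Order.TTheory GRing.Theory Num.Theory.
Local Open Scope classical_set_scope.
Local Open Scope ring_scope.

Set Implicit Arguments.
Unset Strict Implicit.
Unset Printing Implicit Defensive.

(* Evaluate everything at p0. The relation N(s, G, F): "|F x| < |G x| at some
   zero x of s" is definable in (C(X), B), because coprimality of two functions
   means that they have no common zero, and |b| < 1 everywhere means that
   1 - a b is a unit for all a in B. Through N one can speak of the values at p0
   (take s = p) and of the set of limit values at p0 of f / p along the zeros of
   s. This cluster set is a closed definable subset of K, so if it is bounded and
   discrete it is finite, and germs realize every finite set as a cluster set.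
   Hence "h(p0) is a power of g(p0)" is definable when 0 < |g(p0)| < 1: some
   finite cluster set contains 1 and contains g(p0) a with each a <> h(p0).
   The integer n is represented by any h with h(p0) = tau^n. Addition becomes
   multiplication of functions, divisibility of exponents is "being a power of",
   and multiplication is recovered from the two by Robinson's remark that
   n^2 + n = lcm(n, n + 1). *)

(** A formula over the ring quantifies over functions, hence over elements of K through their values
    at p0, but not over finite sets, whereas being a power of g calls for the finite set 1, g, ...,
    g^n. A pair (s, f) is the code of such a set. Boundedness and discreteness are what a formula
    can say in place of finiteness, and finiteness is what keeps the set from containing all powers
    of g. The division by p comes from the functions delta_i that separate the germs. They are
    bounded but need not have a limit at p0, so a step function with value v_i on the i-th germ is
    in general not continuous at p0, while its product with p extends continuously by 0. Integers
    are exponents and not multiples of 1 because K may have positive characteristic, while the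
    powers of tau are always distinct. Multiplying functions only adds exponents, and no
    exponentiation is at hand; this is why the product of exponents has to be reached through
    divisibility. *)

(** * The unit disk of an ordered or valued field *)

(** The order comes as a bare relation on a field. Made into a [realFieldType] on the same carrier,
    it gives access to norms, [lra] and [nra]. *)
Lemma unit_interval_transfer (Q : forall K : fieldType, set K -> Prop) :
  (forall R : realFieldType, Q R [set x : R | `|x| <= 1]) ->
  forall (K : fieldType) (O : set K), is_unit_interval O -> Q K O.
Proof.
(* K is destructured so that the field structure underlying R below is
   convertible to it. *)
move=> HQ [T c]; case: c => ? ? ? ? ? ? ? ? ? ? ? ? ? ? ? O.
set K := GRing.Field.Pack _; move=> [le fo OE].
have add := fo_add fo.
have subr_ge x y : le 0 (y - x) = le x y.
  apply/idP/idP => [/(add _ _ x)|/(add _ _ (- x))].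
    by rewrite subrK add0r.
  by rewrite subrr.
pose lt x y := (y != x) && le x y.
pose norm x := if le 0 x then x else - x.
have opp_ge x : le 0 (- x) = le x 0 by rewrite -sub0r subr_ge.
have add_ge0 x y : le 0 x -> le 0 y -> le 0 (x + y).
  by move=> x0 /(add _ _ x); rewrite add0r addrC; apply: (fo_trans fo).
have anti0 x : le 0 x -> le x 0 -> x = 0.
  by move=> x0 x0'; apply: (fo_anti fo); rewrite x0 x0'.
have normN x : norm (- x) = norm x.
  rewrite /norm opp_ge; case: ifP => h1; case: ifP => h2 //.
  - by rewrite (anti0 x) ?oppr0.
  - by rewrite opprK.
  - by have := fo_total fo 0 x; rewrite h1 h2.
have ge0_norm x : le 0 x -> norm x = x by rewrite /norm => ->.
pose mix := Num.IntegralDomain_isLeReal.Build K add_ge0 (fo_mul fo) anti0 subr_ge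
  (fo_total fo 0) normN ge0_norm (fun x y => erefl (lt x y)).
pose R : realFieldType := HB.pack (GRing.Field.sort K) mix.
have E (x : R) : (`|x| <= 1) = (le (-1) x && le x 1) := ler_norml x 1.
have {}OE : O = [set x : R | `|x| <= 1].
  by rewrite OE; apply/seteqP; split => x /=; rewrite E => /andP.
rewrite OE; exact: (HQ R).
Qed.

(** The condition |z| < 1 in terms of [O] alone, before any [ovfield] is at hand. The value 0 is
    listed apart because [0^-1] is 0, which lies in [O]. *)
Definition below1 (K : fieldType) (O : set K) (z : K) : Prop :=
  z = 0 \/ ~ O z^-1.

(* A continuous function equal to 1 near 0 and to 0 off the open unit disk: for a
   valuation ring take d = 1, c = 0; for [-1, 1] take d = 2, c = 4 / 3. *)
Definition plateau (K : fieldType) (O : set K) (d c z : K) : K :=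
  if `[< below1 O (d * z) >] then 1 else
  if `[< O z >] then c * (1 - z * z) else 0.

(** What the ordered and the valued case have in common; once it is established, no case distinction
    is made. The constants [d] and [c] are existential because they differ in the two cases. *)
Definition disk_facts (K : fieldType) (O : set K) : Prop :=
  [/\ O 1, (forall x, O x -> O (- x)), (forall x y, O x -> O y -> O (x * y)),
      (forall x, x != 0 -> O x \/ O x^-1) &
   [/\ (forall z, below1 O z -> exists2 r, r != 0 &
         forall y, below1 O ((y - z) / r) -> below1 O y) &
      exists d c, [/\ d != 0, (forall z, O (plateau O d c z)),
        (forall z, ~ below1 O z -> plateau O d c z = 0) &
        forall z e, e != 0 -> exists2 r, r != 0 & forall y,
          below1 O ((y - z) / r) ->
          below1 O ((plateau O d c y - plateau O d c z) / e)]]].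

Lemma disk_facts_real (R : realFieldType) : disk_facts [set x : R | `|x| <= 1].
Proof.
set O := [set x : R | _].
have lt1 z : below1 O z <-> `|z| < 1.
  have [->|z0] := eqVneq z 0; first by rewrite normr0 ltr01; split=> // _; left.
  rewrite /below1 /O /= normfV invf_le1 ?normr_gt0 // real_ltNge ?num_real //.
  by split => [[/eqP|/negP//]|/negP h]; [rewrite (negPf z0)|right].
have lt1V z r : r != 0 -> below1 O (z / r) <-> `|z| < `|r|.
  by move=> r0; rewrite lt1 normf_div ltr_pdivrMr ?normr_gt0 // mul1r.
split.
- by rewrite /O /= normr1.
- by move=> x; rewrite /O /= normrN.
- by move=> x y; rewrite /O /= normrM => h1 h2; rewrite -[1]mulr1 ler_pM.
- move=> x x0; rewrite /O /= normfV invf_le1 ?normr_gt0 //.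
  by apply/orP; apply: le_total.
split.
  move=> z /lt1 z1; have r0 : 1 - `|z| != 0 by rewrite gt_eqF // subr_gt0.
  exists (1 - `|z|) => // y /(lt1V _ _ r0).
  rewrite [`|1 - _|]ger0_norm; last by rewrite subr_ge0 ltW.
  move=> h; apply/lt1.
  rewrite -[y](subrK z); apply: (le_lt_trans (ler_normD _ _)); lra.
(* The plateau as a function of w = z^2: it is 1 for w < 1/4, that is for |2z| < 1, and then follows
   the segment from (1/4, 1) to (1, 0), whose slope -4/3 explains [c] and the Lipschitz constant
   below. *)
pose g (w : R) : R := if w < 1 / 4 then 1 else if w <= 1 then 4 / 3 * (1 - w) else 0.
have sq1 (z : R) : (z * z <= 1) = (`|z| <= 1).
  by rewrite -expr2 -[z ^+ 2]real_normK ?num_real // expr_le1.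
have sqlt1 (z : R) : (z * z < 1) = (`|z| < 1).
  by rewrite -expr2 -[z ^+ 2]real_normK ?num_real // expr_lt1.
have gE z : plateau O 2 (4 / 3) z = g (z * z).
  rewrite /plateau /g; have -> : `[< below1 O (2 * z) >] = (z * z < 1 / 4).
    apply/asboolP/idP; rewrite lt1 -sqlt1; lra.
  have -> : `[< O z >] = (z * z <= 1).
    by rewrite sq1; apply/asboolP/idP.
  by [].
exists 2, (4 / 3); split.
- by rewrite pnatr_eq0.
- move=> z; rewrite gE /O /= /g; have := sqr_ge0 z; rewrite expr2.
  case: ltP => h1; first by rewrite normr1.
  move=> h3; case: (leP (z * z)) => h2; rewrite ?normr0 // ler_norml; apply/andP; split; lra.
- move=> z; rewrite lt1 => /negP; rewrite -real_leNgt ?num_real // => h.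
  have {}h : 1 <= z * z by rewrite leNgt sqlt1 -leNgt.
  rewrite gE /g; case: ltP => h1; first by lra.
  by case: leP => h2 //; lra.
move=> z e e0.
have lip w w' : `|g w - g w'| <= 4 / 3 * `|w - w'|.
  have : (w - w' <= `|w - w'|) && (- `|w - w'| <= w - w').
    by rewrite ler_norm lerNl -normrN ler_norm.
  move=> /andP[]; move: (`|w - w'|) => k h1 h2; rewrite ler_norml /g.
  case: (ltP w) => ?; case: (ltP w') => ?; [|case: (leP w') => ?|case: (leP w) => ?|
    case: (leP w) => ?; case: (leP w') => ?]; apply/andP; split; lra.
have e1 : 0 < `|e| by rewrite normr_gt0.
have zz := normr_ge0 z.
(* The bound 1 on |y - z| gives |y + z| <= 2|z| + 1, and the extra factor 2 absorbs the Lipschitz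
   constant 4/3. *)
pose r := Num.min 1 (`|e| / (2 * (2 * `|z| + 1))).
have d0 : 0 < 2 * (2 * `|z| + 1) by lra.
have r1 : r <= 1 by rewrite /r ge_min lexx.
have r2 : r * (2 * (2 * `|z| + 1)) <= `|e|.
  by rewrite -ler_pdivlMr // /r ge_min lexx orbT.
have r0 : 0 < r by rewrite /r lt_min ltr01 divr_gt0.
exists r; first by rewrite gt_eqF.
move=> y /(lt1V _ _ (lt0r_neq0 r0)); rewrite (gtr0_norm r0) => yz.
apply/lt1V => //; rewrite !gE; apply: (le_lt_trans (lip _ _)).
have -> : y * y - z * z = (y - z) * ((y - z) + (z + z)) by ring.
rewrite normrM.
have : `|y - z + (z + z)| <= 2 * `|z| + 1.
  have := ler_normD (y - z) (z + z); have := ler_normD z z; lra.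
move: (`|y - z + _|) (normr_ge0 (y - z + (z + z))) (`|y - z|) (normr_ge0 (y - z)) yz.
move=> u u0 v v0 h1 h2.
nra.
Qed.

(** The open unit disk is the maximal ideal of [O], an additive subgroup, so membership in it is
    constant on balls of radius 1. The plateau is its indicator function, and radius 1 serves for
    every [e]. *)
Lemma disk_facts_valuation (K : fieldType) (O : set K) :
  is_valuation_ring O -> disk_facts O.
Proof.
move=> [G [le [v [go nv OE]]]].
have OP x : O x <-> x = 0 \/ le 0 (v x) by rewrite OE.
have R : reflexive le by move=> x; have := go_total go x x; rewrite orbb.
have leN (x : G) : le 0 x = le (- x) 0.
  apply/idP/idP => [/(go_add go (- x))|/(go_add go x)].
    by rewrite add0r subrr.
  by rewrite addNr add0r.
have dbl0 (x : G) : x + x = 0 -> x = 0.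
  have pos (y : G) : le 0 y -> y + y = 0 -> y = 0.
    move=> y0 yy; apply: (go_anti go); rewrite y0 andbT.
    by have := go_add go y y0; rewrite yy add0r.
  move=> xx; have /orP[h|h] := go_total go 0 x; first exact: pos.
  by apply: oppr_inj; rewrite oppr0; apply: pos; rewrite ?leN ?opprK // -opprD xx oppr0.
have v1 : v 1 = 0.
  by apply: (addrI (v 1)); rewrite addr0 -(val_mul nv) ?oner_neq0 // mulr1.
have vV x : x != 0 -> v x^-1 = - v x.
  by move=> x0; apply: (addrI (v x)); rewrite -(val_mul nv) ?invr_eq0 // divff // subrr.
have vN x : x != 0 -> v (- x) = v x.
  move=> x0; rewrite -mulN1r (val_mul nv) ?oppr_eq0 ?oner_neq0 // [v (-1)]dbl0 ?add0r //.
  by rewrite -(val_mul nv) ?oppr_eq0 ?oner_neq0 // mulrNN mulr1.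
have OM x y : O x -> O y -> O (x * y).
  have [->|x0] := eqVneq x 0; first by move=> *; apply/OP; left; rewrite mul0r.
  have [->|y0] := eqVneq y 0; first by move=> *; apply/OP; left; rewrite mulr0.
  move=> /OP[/eqP|hx]; first by rewrite (negbTE x0).
  move=> /OP[/eqP|hy]; first by rewrite (negbTE y0).
  apply/OP; right; rewrite (val_mul nv) //; apply: (go_trans go hy).
  by have := go_add go (v y) hx; rewrite add0r.
have lt1 z : below1 O z <-> z = 0 \/ (le 0 (v z) /\ v z <> 0).
  have [->|z0] := eqVneq z 0; first by split; left.
  split=> [[/eqP|nO]|[/eqP|[h1 h2]]]; rewrite ?(negPf z0) //.
    have h : ~ le (v z) 0.
      by move=> h; apply: nO; apply/OP; right; rewrite vV // leN opprK.
    by right; split; [have /orP[] := go_total go 0 (v z)|move=> e; apply: h; rewrite e].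
  right=> /OP[/eqP|]; first by rewrite invr_eq0 (negPf z0).
  by rewrite vV // leN opprK => h; apply: h2; apply: (go_anti go); rewrite h h1.
have ltD x y : below1 O x -> below1 O y -> below1 O (x + y).
  have [->|x0] := eqVneq x 0; first by rewrite add0r.
  have [->|y0] := eqVneq y 0; first by rewrite addr0.
  have [->|xy0] := eqVneq (x + y) 0; first by move=> _ _; left.
  move=> /lt1[/eqP|[hx hx']]; first by rewrite (negbTE x0).
  move=> /lt1[/eqP|[hy hy']]; first by rewrite (negbTE y0).
  have gt (a b : G) : le 0 a -> a <> 0 -> le a b -> le 0 b /\ b <> 0.
    move=> a0 an ab; split; first exact: (go_trans go a0).
    by move=> b0; apply: an; apply: (go_anti go); rewrite -{1}b0 ab.
  by apply/lt1; right; case: (val_add nv x0 y0 xy0); apply: gt.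
have ltN x : below1 O x -> below1 O (- x).
  have [->|x0] := eqVneq x 0; first by rewrite oppr0.
  by move=> /lt1 h; apply/lt1; rewrite vN //; case: h => [->|]; [left; rewrite oppr0|right].
have O1 : O 1 by apply/OP; right; rewrite v1.
have local z y : below1 O ((y - z) / 1) -> below1 O y = below1 O z.
  rewrite divr1 => h; apply/propext; split => hy; last by rewrite -(subrK z y); apply: ltD.
  by have := ltD _ _ hy (ltN _ h); rewrite opprB addrC subrK.
split=> //.
- move=> x /OP[->|h]; first by rewrite oppr0; apply/OP; left.
  have [->|x0] := eqVneq x 0; first by rewrite oppr0; apply/OP; left.
  by apply/OP; right; rewrite vN.
- move=> x x0; have /orP[h|h] := go_total go 0 (v x); first by left; apply/OP; right.
  by right; apply/OP; right; rewrite vV // leN opprK.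
split=> [z z1|]; first by exists 1; rewrite ?oner_neq0 // => y /local ->.
have bE z : plateau O 1 0 z = if `[< below1 O z >] then 1 else 0.
  by rewrite /plateau mul1r mul0r; case: asboolP => // _; case: asboolP.
exists 1, 0; split=> //.
- exact: oner_neq0.
- by move=> z; rewrite bE; case: ifP => // _; apply/OP; left.
- by move=> z nz; rewrite bE asboolF.
move=> z e e0; exists 1; rewrite ?oner_neq0 // => y /local h.
by rewrite !bE h subrr mul0r; left.
Qed.

Lemma disk_factsP (K : ovfield) : disk_facts (@ovring K).
Proof.
case: (ovringP K) => [|/disk_facts_valuation//].
by apply: (@unit_interval_transfer disk_facts); apply: disk_facts_real.
Qed.

(** * The absolute value of an ordered or valued field *)

Section AbsoluteValue.
Variable K : ovfield.
Implicit Types x y z e r : K.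
Local Notation O := (@ovring K).

Lemma ovring1 : O 1. Proof. by case: (disk_factsP K). Qed.

Lemma ovringM x y : O x -> O y -> O (x * y).
Proof. by case: (disk_factsP K) => _ _ OM _ _; apply: OM. Qed.

Lemma ovringN x : O x -> O (- x).
Proof. by case: (disk_factsP K) => _ ON _ _ _; apply: ON. Qed.

Lemma abslexx x : absle x x.
Proof. by exists 1; [exact: ovring1|rewrite mulr1]. Qed.

Lemma absle_trans y x z : absle x y -> absle y z -> absle x z.
Proof.
move=> [a Oa ->] [b Ob ->]; exists (b * a); last by rewrite mulrA.
exact: ovringM.
Qed.

Lemma absle_total x y : absle x y \/ absle y x.
Proof.
have [_ _ _ tot _] := disk_factsP K.
have O0 : O 0.
  by have [[a Oa]] := abslt0 (oner_neq0 K); rewrite mul1r => ->.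
have [->|x0] := eqVneq x 0; first by left; exists 0; rewrite ?mulr0.
have [->|y0] := eqVneq y 0; first by right; exists 0; rewrite ?mulr0.
case: (tot (x / y)) => [|h|]; first by rewrite mulf_neq0 ?invr_eq0.
  by left; exists (x / y); rewrite // mulrC divfK.
by rewrite invf_div => h; right; exists (y / x); rewrite // mulrC divfK.
Qed.

Lemma absltNge x y : abslt x y <-> ~ absle y x.
Proof.
split=> [[]//|nxy]; split=> //; by case: (absle_total x y).
Qed.

Lemma absleNgt x y : ~ abslt x y <-> absle y x.
Proof. by rewrite absltNge; split=> [/contrapT|h /(_ h)]. Qed.

Lemma abslt_le_trans y x z : abslt x y -> absle y z -> abslt x z.
Proof.
move=> [xy nyx] yz; split; first exact: absle_trans yz.
by move=> zx; apply: nyx; apply: absle_trans zx.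
Qed.

Lemma absle_lt_trans y x z : absle x y -> abslt y z -> abslt x z.
Proof.
move=> xy [yz nzy]; split; first exact: absle_trans yz.
by move=> zx; apply: nzy; apply: absle_trans xy.
Qed.

Lemma abslt_trans y x z : abslt x y -> abslt y z -> abslt x z.
Proof. by move=> /abslt_le_trans h [/h]. Qed.

Lemma ovring_absle x : O x <-> absle x 1.
Proof. by split=> [h|[a h ->]]; [exists x; rewrite ?mul1r|rewrite mul1r]. Qed.

Lemma absleM x y z t : absle x y -> absle z t -> absle (x * z) (y * t).
Proof.
by move=> [a Oa ->] [b Ob ->]; exists (a * b); [exact: ovringM|rewrite mulrACA].
Qed.

Lemma absle_pmul2r z x y : z != 0 -> absle (x * z) (y * z) <-> absle x y.
Proof.
move=> z0; split=> [[a Oa]|h]; last by apply: absleM => //; exact: abslexx.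
by rewrite mulrAC => /(mulIf z0) ->; exists a.
Qed.

Lemma abslt_pmul2r z x y : z != 0 -> abslt (x * z) (y * z) <-> abslt x y.
Proof. by move=> z0; rewrite !absltNge absle_pmul2r. Qed.

Lemma abslt_div2r z x y : z != 0 -> abslt (x / z) y <-> abslt x (y * z).
Proof. by move=> z0; rewrite -(abslt_pmul2r _ _ z0) divfK. Qed.

Lemma abslt_neq0 x y : abslt x y -> y != 0.
Proof.
by move=> [[a _ ->]] nle; apply: contra_notN nle => /eqP ->; rewrite mul0r; exact: abslexx.
Qed.

Lemma abslt_0l x : abslt 0 x <-> x != 0.
Proof. by split=> [/abslt_neq0|/abslt0]. Qed.

Lemma absltxx x : ~ abslt x x.
Proof. by move=> []. Qed.

Lemma absleNr x y : absle x (- y) <-> absle x y.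
Proof.
have key v : absle x v -> absle x (- v).
  by move=> [a Oa ->]; exists (- a); [exact: ovringN|rewrite mulrNN].
by split=> /key //; rewrite opprK.
Qed.

Lemma absltN x y : abslt (- x) y <-> abslt x y.
Proof. by rewrite !absltNge absleNr. Qed.

Lemma abslt_subC x y z : abslt (x - y) z <-> abslt (y - x) z.
Proof. by rewrite -absltN opprB. Qed.

Lemma abslt_below1 x : abslt x 1 <-> below1 O x.
Proof.
have [->|x0] := eqVneq x 0.
  by split=> _; [left|apply: abslt0; exact: oner_neq0].
have -> : below1 O x <-> ~ O x^-1.
  by split=> [[/eqP|//]|]; [rewrite (negPf x0)|right].
rewrite absltNge ovring_absle -(absle_pmul2r x^-1 1 x0).
by rewrite mul1r mulVf.
Qed.

Lemma abslt_ball_center x : abslt x 1 -> exists2 r, r != 0 &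
  forall y, abslt (y - x) r -> abslt y 1.
Proof.
have [_ _ _ _ [H _]] := disk_factsP K.
move=> /abslt_below1/H[r r0 h]; exists r => // y; rewrite -[r]mul1r -abslt_div2r //.
by move=> /abslt_below1/h/abslt_below1.
Qed.

(** This stands in for the triangle inequality, whose form depends on the case: [e] has to be halved
    for an order but not for a valuation. *)
Lemma abslt_split e : e != 0 -> exists2 r, r != 0 & absle r e /\
  (forall x y, abslt x r -> abslt y r -> abslt (x + y) e /\ abslt (x - y) e).
Proof.
move=> e0; have [r r0 H] := abslt_add e0; have [s s0 H'] := abslt_sub e0.
have [t t0 Ht] := abslt_min r0 s0; have [t' t'0 Ht'] := abslt_min t0 e0.
exists t' => //; split.
  case: (absle_total t' e) => // et.
  apply: contrapT => te; have : abslt e t' by split.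
  by move=> /Ht'[_ /absltxx].
by move=> x y /Ht'[/Ht[x1 x2] _] /Ht'[/Ht[y1 y2] _]; split; [apply: H|apply: H'].
Qed.

Lemma abslt_far e : e != 0 -> exists2 r, r != 0 &
  forall x y, absle e x -> abslt (y - x) r -> absle r y.
Proof.
move=> e0; have [r r0 [_ H]] := abslt_split e0; exists r => // x y ex yx.
apply/absleNgt => yr; have [_] := H _ _ yr yx.
by rewrite opprB addrC subrK; move=> /absltNge.
Qed.

End AbsoluteValue.

(** * Definable predicates *)

Section Definability.
Variables (L : language) (M : Type) (SM : structure L M) (P : Type) (c : P -> M).

(* Definability uniformly in the set V of variables into which the coordinates
   and the parameters are embedded, so that no renaming of formulas is needed
   under quantifiers. *)
Definition dterm (I : Type) (t : (I -> M) -> M) : Prop :=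
  forall V (h : I -> V) (k : P -> V), exists u : term L V,
    forall e, e \o k = c -> teval SM e u = t (e \o h).

Definition dpred (I : Type) (A : (I -> M) -> Prop) : Prop :=
  forall V (h : I -> V) (k : P -> V), exists phi : formula L V,
    forall e, e \o k = c -> (sat SM phi e <-> A (e \o h)).

Lemma dpred_definable I (A : set (I -> M)) : dpred A -> definable_over SM c A.
Proof.
move=> /(_ _ inl inr)[phi Hphi]; exists phi => x.
by rewrite Hphi.
Qed.

Variable I : Type.
Implicit Types (t u : (I -> M) -> M) (A B : (I -> M) -> Prop).

Lemma dterm_var i : dterm (fun x : I -> M => x i).
Proof. by move=> V h k; exists (Var _ (h i)). Qed.

Lemma dterm_param q : dterm (fun _ : I -> M => c q).
Proof. by move=> V h k; exists (Var _ (k q)) => e <-. Qed.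

Lemma dterm_app (f : Defs.fsym L) (a : 'I_(far f) -> (I -> M) -> M) :
  (forall i, dterm (a i)) -> dterm (fun x => ifun SM (fun i => a i x)).
Proof.
move=> Ha V h k; have [u Hu] := boolp.choice (fun i => Ha i V h k).
exists (App u) => e ek /=; congr (ifun SM _).
by apply/funext => i; rewrite Hu.
Qed.

Lemma dpred_rel (r : rsym L) (a : 'I_(rar r) -> (I -> M) -> M) :
  (forall i, dterm (a i)) -> dpred (fun x => irel SM (fun i => a i x)).
Proof.
move=> Ha V h k; have [u Hu] := boolp.choice (fun i => Ha i V h k).
exists (FRel u) => e ek /=.
suff -> : (fun i => teval SM e (u i)) = (fun i => a i (e \o h)) by [].
by apply/funext => i; rewrite Hu.
Qed.

Lemma dpred_eq t u : dterm t -> dterm u -> dpred (fun x => t x = u x).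
Proof.
move=> Ht Hu V h k; have [t' Ht'] := Ht V h k; have [u' Hu'] := Hu V h k.
by exists (FEq t' u') => e ek /=; rewrite Ht' // Hu'.
Qed.

Lemma dpred_ext A B : dpred A -> (forall x, A x <-> B x) -> dpred B.
Proof.
move=> HA AB V h k; have [phi H] := HA V h k; exists phi => e ek.
by rewrite H.
Qed.

Lemma dpred_and A B : dpred A -> dpred B -> dpred (fun x => A x /\ B x).
Proof.
move=> HA HB V h k; have [p Hp] := HA V h k; have [q Hq] := HB V h k.
by exists (FAnd p q) => e ek /=; rewrite Hp // Hq.
Qed.

Lemma dpred_or A B : dpred A -> dpred B -> dpred (fun x => A x \/ B x).
Proof.
move=> HA HB V h k; have [p Hp] := HA V h k; have [q Hq] := HB V h k.
by exists (FOr p q) => e ek /=; rewrite Hp // Hq.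
Qed.

Lemma dpred_imp A B : dpred A -> dpred B -> dpred (fun x => A x -> B x).
Proof.
move=> HA HB V h k; have [p Hp] := HA V h k; have [q Hq] := HB V h k.
by exists (FImp p q) => e ek /=; rewrite Hp // Hq.
Qed.

Lemma dpred_not A : dpred A -> dpred (fun x => ~ A x).
Proof.
move=> HA V h k; have [p Hp] := HA V h k.
by exists (FImp p (FFalse _ _)) => e ek /=; rewrite Hp.
Qed.

Lemma dpred_true : dpred (fun _ : I -> M => True).
Proof. by move=> V h k; exists (FImp (FFalse L V) (FFalse L V)) => e _ /=; split. Qed.

Lemma dpred_ex (Q : M -> (I -> M) -> Prop) :
  dpred (fun y : option I -> M => Q (y None) (y \o Some)) ->
  dpred (fun x => exists a, Q a x).
Proof.
move=> HQ V h k; have [p Hp] := HQ (option V) (omap h) (Some \o k).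
exists (FEx p) => e ek /=.
have {}Hp a : sat SM p (econs a e) <-> Q a (e \o h) := Hp (econs a e) ek.
by split=> -[a Ha]; exists a; apply/Hp.
Qed.

Lemma dpred_all (Q : M -> (I -> M) -> Prop) :
  dpred (fun y : option I -> M => Q (y None) (y \o Some)) ->
  dpred (fun x => forall a, Q a x).
Proof.
move=> HQ V h k; have [p Hp] := HQ (option V) (omap h) (Some \o k).
exists (FAll p) => e ek /=.
have {}Hp a : sat SM p (econs a e) <-> Q a (e \o h) := Hp (econs a e) ek.
by split=> H a; apply/Hp.
Qed.

Lemma dpred_forall_ord n (Q : 'I_n -> (I -> M) -> Prop) :
  (forall i, dpred (Q i)) -> dpred (fun x => forall i, Q i x).
Proof.
move=> HQ.
suff H (s : seq 'I_n) : dpred (fun x => forall i, i \in s -> Q i x).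
  by apply: (dpred_ext (H (enum 'I_n))) => x; split=> [h i|//]; apply: h; rewrite mem_enum.
elim: s => [|i s IH]; first by apply: (dpred_ext dpred_true).
apply: (dpred_ext (dpred_and (HQ i) IH)) => x; split=> [[h1 h2] j|h].
  by rewrite inE => /orP[/eqP ->|/h2].
by split=> [|j js]; apply: h; rewrite inE ?eqxx // js orbT.
Qed.

End Definability.

Lemma dpred_reindex L M (SM : structure L M) P (c : P -> M) I J (h : I -> J)
  (A : (I -> M) -> Prop) : dpred SM c A -> dpred SM c (fun x => A (x \o h)).
Proof. by move=> HA V g k; apply: (HA V (g \o h) k). Qed.

Lemma dterm_reindex L M (SM : structure L M) P (c : P -> M) I J (h : I -> J)
  (t : (I -> M) -> M) : dterm SM c t -> dterm SM c (fun x => t (x \o h)).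
Proof. by move=> Ht V g k; apply: (Ht V (g \o h) k). Qed.

(** A quantifier binds one element at a time; this allows quantification over points of K^m, by
    splitting off coordinate 0 with [cons]. *)
Lemma dpred_ex_ord L M (SM : structure L M) P (c : P -> M) n I
  (Q : ('I_n -> M) -> (I -> M) -> Prop) :
  dpred SM c (fun z : I + 'I_n -> M => Q (z \o inr) (z \o inl)) ->
  dpred SM c (fun x => exists y, Q y x).
Proof.
elim: n I Q => [|n IH] I Q HQ.
  pose h (v : I + 'I_0) : I :=
    match v with inl i => i | inr j => False_rect _ (notF (ltn_ord j)) end.
  apply: (dpred_ext (dpred_reindex h HQ)) => x.
  have e0 (y y' : 'I_0 -> M) : y = y' by apply/funext => -[].
  by split=> [H|[y Hy]]; [exists ((x \o h) \o inr)|rewrite (e0 (_ \o inr) y)].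
pose cons (a : M) (y : 'I_n -> M) (i : 'I_n.+1) : M :=
  if unlift ord0 i is Some j then y j else a.
apply: (@dpred_ext _ _ _ _ _ _ (fun x => exists a, exists y, Q (cons a y) x)).
  apply: dpred_ex; apply: IH.
  pose h (v : I + 'I_n.+1) : option I + 'I_n := match v with
    | inl i => inl (Some i)
    | inr i => if unlift ord0 i is Some j then inr j else inl None end.
  apply: (dpred_ext (dpred_reindex h HQ)) => z /=.
  suff -> : (z \o h) \o inr = cons (z (inl None)) (z \o inr) by [].
  by apply/funext => i; rewrite /= /cons; case: unlift.
move=> x; split=> [[a [y Hy]]|[y Hy]]; first by exists (cons a y).
exists (y ord0), (y \o lift ord0); suff -> : cons (y ord0) (y \o lift ord0) = y by [].
by apply/funext => i; rewrite /cons; case: unliftP => [j ->|->].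
Qed.

Section RingTerms.
Variables (R : pzRingType) (O : set R) (P : Type) (c : P -> R) (I : Type).
Local Notation SR := (ring_pred_structure O).
Implicit Types t u : (I -> R) -> R.

Lemma dterm_rone : dterm SR c (fun _ : I -> R => 1).
Proof.
exact: (@dterm_app _ _ SR _ c I ROne (fun _ _ => 1)
  (fun i => match notF (ltn_ord i) with end)).
Qed.

Lemma dterm_radd t u : dterm SR c t -> dterm SR c u -> dterm SR c (fun x => t x + u x).
Proof.
move=> Ht Hu.
apply: (@dterm_app _ _ SR _ c I RAdd (fun i => if i == ord0 then t else u)) => i.
by case: ifP.
Qed.

Lemma dterm_rmul t u : dterm SR c t -> dterm SR c u -> dterm SR c (fun x => t x * u x).
Proof.
move=> Ht Hu.
apply: (@dterm_app _ _ SR _ c I RMul (fun i => if i == ord0 then t else u)) => i.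
by case: ifP.
Qed.

Lemma dterm_ropp t : dterm SR c t -> dterm SR c (fun x => - t x).
Proof. by move=> Ht; apply: (@dterm_app _ _ SR _ c I ROpp (fun=> t)). Qed.

Lemma dterm_rsub t u : dterm SR c t -> dterm SR c u -> dterm SR c (fun x => t x - u x).
Proof. by move=> Ht Hu; apply: dterm_radd => //; apply: dterm_ropp. Qed.

Lemma dpred_rpred t : dterm SR c t -> dpred SR c (fun x => O (t x)).
Proof. by move=> Ht; apply: (@dpred_rel _ _ SR _ c I tt (fun=> t)). Qed.

End RingTerms.

Section FieldTerms.
Variables (K : ovfield) (L : language) (S : structure L K).
Local Notation E := (expansion S).
Local Notation LL := (lang_sum ring_pred_lang L).

Lemma dpred_of_definable I (A : set (I -> K)) : definable E A -> dpred E id A.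
Proof.
move=> [phi Hphi] V h k.
exists (frename (fun v => match v with inl i => h i | inr a => k a end) phi) => e ek.
rewrite sat_rename Hphi; suff -> : env_sum (e \o h) id =
  e \o (fun v => match v with inl i => h i | inr a => k a end) by [].
by apply/funext => -[i//|a] /=; rewrite -[RHS]/((e \o k) a) ek.
Qed.

Variable I : Type.
Implicit Types t u : (I -> K) -> K.

Lemma dterm_const (a : K) : dterm E id (fun _ : I -> K => a).
Proof. exact: (dterm_param E id a). Qed.

Lemma dterm_add t u : dterm E id t -> dterm E id u -> dterm E id (fun x => t x + u x).
Proof.
move=> Ht Hu.
apply: (@dterm_app _ _ E _ id I (inl RAdd) (fun i => if i == ord0 then t else u)) => i.
by case: ifP.
Qed.

Lemma dterm_mul t u : dterm E id t -> dterm E id u -> dterm E id (fun x => t x * u x).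
Proof.
move=> Ht Hu.
apply: (@dterm_app _ _ E _ id I (inl RMul) (fun i => if i == ord0 then t else u)) => i.
by case: ifP.
Qed.

Lemma dterm_sub t u : dterm E id t -> dterm E id u -> dterm E id (fun x => t x - u x).
Proof.
move=> Ht Hu; apply: dterm_add => //.
by apply: (@dterm_app _ _ E _ id I (inl ROpp) (fun=> u)).
Qed.

Lemma dpred_ovring t : dterm E id t -> dpred E id (fun x => ovring (t x)).
Proof. by move=> Ht; apply: (@dpred_rel _ _ E _ id I (inl tt) (fun=> t)). Qed.

End FieldTerms.

Section AbsoluteValueTerms.
Variables (K : ovfield) (L : language) (S : structure L K) (I : Type).
Local Notation E := (expansion S).
Implicit Types t u : (I -> K) -> K.

Lemma dpred_absle t u : dterm E id t -> dterm E id u ->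
  dpred E id (fun x => absle (t x) (u x)).
Proof.
move=> Ht Hu; apply: (@dpred_ext _ _ _ _ _ _
  (fun x => exists a, ovring a /\ t x = u x * a)); last first.
  by move=> x; split=> [[a []]|[a]]; exists a.
apply: dpred_ex; apply: dpred_and; first by apply: dpred_ovring; apply: dterm_var.
apply: dpred_eq; first exact: dterm_reindex.
by apply: dterm_mul; [exact: dterm_reindex|exact: dterm_var].
Qed.

Lemma dpred_abslt t u : dterm E id t -> dterm E id u ->
  dpred E id (fun x => abslt (t x) (u x)).
Proof.
by move=> Ht Hu; apply: dpred_and; [|apply: dpred_not]; apply: dpred_absle.
Qed.

End AbsoluteValueTerms.

(** Being constant near 0 and off the disk is what allows functions built from [beta] to be divided
    by functions that have zeros. A single [beta] serves all languages, since it is definable from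
    the ring operations and [ovring]. *)
Lemma flat_bump (K : ovfield) : exists beta : K -> K,
  [/\ (forall z e, e != 0 -> exists2 r, r != 0 &
        forall y, abslt (y - z) r -> abslt (beta y - beta z) e),
      (forall z, ovring (beta z)),
      (exists2 r, r != 0 & forall z, abslt z r -> beta z = 1),
      (forall z, ~ abslt z 1 -> beta z = 0) &
      forall L (S : structure L K) I (i j : I),
        definable (expansion S) [set x : I -> K | x i = beta (x j)]].
Proof.
have [_ _ _ _ [_ [d [c [d0 HO H0 HC]]]]] := disk_factsP K.
exists (plateau (@ovring K) d c).
have lt1 (x y r : K) : r != 0 -> abslt (y - x) r <-> below1 (@ovring K) ((y - x) / r).
  by move=> r0; rewrite -abslt_below1 abslt_div2r // mul1r.
split=> //.
- move=> z e e0; have [r r0 H] := HC z e e0; exists r => // y.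
  by rewrite !lt1 //; apply: H.
- exists d^-1; first by rewrite invr_eq0.
  move=> z h; rewrite /plateau asboolT //; apply/abslt_below1.
  by rewrite mulrC -[d]invrK abslt_div2r ?invr_eq0 // mul1r.
- by move=> z nz; apply: H0 => /abslt_below1.
move=> L S I i j; apply: dpred_definable.
pose b1 (x : I -> K) := abslt (d * x j) 1.
apply: (@dpred_ext _ _ _ _ _ _ (fun x =>
  (b1 x -> x i = 1) /\ (~ b1 x -> (ovring (x j) -> x i = c * (1 - x j * x j)) /\
                                  (~ ovring (x j) -> x i = 0)))).
  by do ?[apply: dpred_abslt|apply: dpred_ovring|apply: dpred_not|apply: dpred_and
         |apply: dpred_imp|apply: dpred_eq|apply: dterm_mul|apply: dterm_sub
         |apply: dterm_var|apply: dterm_const].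
move=> x /=; have := abslt_below1 (d * x j); rewrite -/(b1 x) /plateau.
have [h|h] := pselect (below1 (@ovring K) (d * x j)).
  by rewrite asboolT //; tauto.
rewrite asboolF //; have [h'|h'] := pselect (ovring (x j)).
  by rewrite asboolT //; tauto.
by rewrite asboolF //; tauto.
Qed.

(** * Bump functions and coprimality in C(X) *)

Section ContinuousFunctions.
Variables (K : ovfield) (L : language) (S : structure L K) (m : nat).
Variable X : defset S m.
Local Notation E := (expansion S).
Local Notation O := (@ovring K).
Implicit Types (a x : X) (f g : X -> K) (P Q : X -> Prop).

Definition near_at a P : Prop :=
  exists2 r : K, r != 0 & forall x, oball (val a) r (val x) -> P x.

Definition cont_at f a : Prop :=
  forall e : K, e != 0 -> near_at a (fun x => abslt (f x - f a) e).

Lemma oball_center (z : 'I_m -> K) (r : K) : r != 0 -> oball z r z.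
Proof. by move=> r0 i; rewrite subrr; apply: abslt0. Qed.

Lemma near_at_self a P : near_at a P -> P a.
Proof. by move=> [r r0]; apply; apply: oball_center. Qed.

Lemma near_at_mono a P Q : near_at a P -> (forall x, P x -> Q x) -> near_at a Q.
Proof. by move=> [r r0 H] PQ; exists r => // x /H/PQ. Qed.

Lemma near_at_and a P Q : near_at a P -> near_at a Q -> near_at a (fun x => P x /\ Q x).
Proof.
move=> [r r0 H] [s s0 H']; have [t t0 Ht] := abslt_min r0 s0.
by exists t => // x xt; split; [apply: H|apply: H'] => i; have [] := Ht _ (xt i).
Qed.

Lemma cont_at_near_eq f g a : near_at a (fun x => f x = g x) -> cont_at g a -> cont_at f a.
Proof.
move=> fg Hg e e0; apply: near_at_mono (near_at_and fg (Hg e e0)) _ => x [-> ].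
by rewrite (near_at_self fg).
Qed.

Lemma cont_at_cst (c : K) a : cont_at (fun=> c) a.
Proof.
by move=> e e0; exists 1; [exact: oner_neq0|move=> x _; rewrite subrr; exact: abslt0].
Qed.

Lemma cont_at_op (op : K -> K -> K) f g a :
  (forall b c e : K, e != 0 -> exists2 r, r != 0 &
    forall y z, abslt (y - b) r -> abslt (z - c) r -> abslt (op y z - op b c) e) ->
  cont_at f a -> cont_at g a -> cont_at (fun x => op (f x) (g x)) a.
Proof.
move=> Hop Hf Hg e /(Hop (f a) (g a))[r r0 H].
by apply: near_at_mono (near_at_and (Hf _ r0) (Hg _ r0)) _ => x [h1 h2]; apply: H.
Qed.

Lemma cont_at_sub f g a : cont_at f a -> cont_at g a -> cont_at (fun x => f x - g x) a.
Proof. exact: cont_at_op (@op_sub K). Qed.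

Lemma cont_at_mul f g a : cont_at f a -> cont_at g a -> cont_at (fun x => f x * g x) a.
Proof. exact: cont_at_op (@op_mul K). Qed.

Lemma cont_at_comp (phi : K -> K) f a :
  (forall e, e != 0 -> exists2 r, r != 0 &
     forall y, abslt (y - f a) r -> abslt (phi y - phi (f a)) e) ->
  cont_at f a -> cont_at (fun x => phi (f x)) a.
Proof.
by move=> H Hf e /H[r r0 {}H]; apply: near_at_mono (Hf r r0) _ => x /H.
Qed.

Lemma near_at_absge f a : cont_at f a -> f a != 0 -> exists2 r, r != 0 &
  near_at a (fun x => absle r (f x)).
Proof.
move=> Hf fa; have [r r0 H] := abslt_far fa; exists r => //.
by apply: near_at_mono (Hf r r0) _ => x; apply: H; exact: abslexx.
Qed.

Lemma absle_neq0 (r z : K) : r != 0 -> absle r z -> z != 0.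
Proof.
by move=> r0 [c _ E0]; apply: contra_neq r0 => z0; rewrite E0 z0 mul0r.
Qed.

Lemma near_at_neq0 f a : cont_at f a -> f a != 0 -> near_at a (fun x => f x != 0).
Proof.
move=> Hf /(near_at_absge Hf)[r r0 H]; apply: near_at_mono H _ => x.
exact: absle_neq0.
Qed.

Lemma cont_at_inv f a : cont_at f a -> f a != 0 -> cont_at (fun x => (f x)^-1) a.
Proof.
move=> Hf fa; have [r r0 Hr] := near_at_absge Hf fa => e e0.
(* Since |f x| >= |r| near [a], a numerator smaller than |e r f(a)| makes the quotient smaller than
   |e|. *)
have c0 : e * r * f a != 0 by rewrite !mulf_neq0.
apply: near_at_mono (near_at_and Hr (Hf _ c0)) _ => x [rx].
have fx := absle_neq0 r0 rx; rewrite abslt_subC => h.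
have -> : (f x)^-1 - (f a)^-1 = (f a - f x) / (f x * f a) by field; rewrite fx fa.
rewrite abslt_div2r ?mulf_neq0 //; apply: abslt_le_trans h _.
rewrite mulrA; apply: absleM; last exact: abslexx.
by apply: absleM => //; exact: abslexx.
Qed.

Definition gdef f : Prop := definable E (graph f).

Lemma gdef_sub f g : gdef f -> gdef g -> gdef (fun x => f x - g x).
Proof. by apply: (graph_op (op := fun y z => y - z)) => I i j k; apply: definable_sub. Qed.

Lemma gdef_mul f g : gdef f -> gdef g -> gdef (fun x => f x * g x).
Proof. by apply: (graph_op (op := fun y z => y * z)) => I i j k; apply: definable_mul. Qed.

Lemma gdef_comp (phi : K -> K) f :
  (forall I (i j : I), definable E [set x : I -> K | x i = phi (x j)]) ->
  gdef f -> gdef (fun x => phi (f x)).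
Proof. by move=> H Hf; apply: (graph_op (op := fun y _ => phi y) _ Hf Hf) => I i j _. Qed.

Lemma gdef_inv f : gdef f -> gdef (fun x => (f x)^-1).
Proof.
apply: (gdef_comp (phi := GRing.inv)) => I i j; apply: dpred_definable.
apply: (@dpred_ext _ _ _ _ _ _ (fun x : I -> K => (x j = 0 /\ x i = 0) \/ x i * x j = 1)).
  by do ?[apply: dpred_or|apply: dpred_and|apply: dpred_eq|apply: dterm_mul
         |apply: dterm_var|apply: dterm_const].
move=> x /=; have [->|xj] := eqVneq (x j) 0.
  by rewrite invr0 mulr0; split=> [[[]//|/esym/eqP]|h]; [rewrite oner_eq0|left].
split=> [[[/eqP]|h]|->]; first by rewrite (negPf xj).
  by apply: (mulIf xj); rewrite h mulVf.
by right; rewrite mulVf.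
Qed.

Lemma gdef_restr (h : K -> ('I_m -> K) -> Prop) f :
  dpred E id (fun z : option 'I_m -> K => h (z None) (z \o Some)) ->
  (forall x v, h v (val x) <-> f x = v) -> gdef f.
Proof.
move=> Hh hf; have HX := dpred_reindex (@Some 'I_m) (dpred_of_definable (defsetP X)).
apply: dpred_definable; apply: dpred_ext (dpred_and HX Hh) _ => z; split.
  move=> [Xz hz]; exists (SigSub (mem_set Xz)) => //.
  exact/hf.
move=> [x xE fz]; have xE' : z \o Some = val x by rewrite xE.
by rewrite xE'; split; [exact: set_valP|apply/hf].
Qed.

Lemma gdef_cst (c : K) : gdef (fun=> c).
Proof.
apply: (@gdef_restr (fun v _ => c = v)) => //.
by apply: dpred_eq; [apply: dterm_const|apply: dterm_var].
Qed.

Lemma gdef_coord i : gdef (fun x => val x i).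
Proof.
apply: (@gdef_restr (fun v z => z i = v)) => //.
by apply: dpred_eq; apply: dterm_var.
Qed.

Lemma contring_intro f : (forall a, cont_at f a) -> gdef f ->
  exists s : contring X, forall x, s x = f x.
Proof.
move=> Hc Hg; have H : f \in @contdef_pred K L S m X by apply/asboolP; split.
by exists (ContRing H).
Qed.

Lemma contring_cont (s : contring X) a : cont_at s a.
Proof. by have /asboolP[H _] := contring_mem s; apply: H. Qed.

Lemma contring_gdef (s : contring X) : gdef s.
Proof. by have /asboolP[] := contring_mem s. Qed.

Lemma contring_ext (s t : contring X) : (forall x, s x = t x) -> s = t.
Proof. by move=> H; apply/val_inj/funext. Qed.

Lemma contringDE (s t : contring X) x : (s + t) x = s x + t x. Proof. by []. Qed.
Lemma contringNE (s : contring X) x : (- s) x = - s x. Proof. by []. Qed.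
Lemma contringME (s t : contring X) x : (s * t) x = s x * t x. Proof. by []. Qed.
Lemma contring1E x : (1 : contring X) x = 1. Proof. by []. Qed.
Lemma contring0E x : (0 : contring X) x = 0. Proof. by []. Qed.

Definition contringE := (contringDE, contringNE, contringME, contring1E, contring0E).

Lemma contring_sumE I (s : seq I) (F : I -> contring X) x :
  (\sum_(i <- s) F i) x = \sum_(i <- s) F i x.
Proof. by elim/big_rec2: _ => // i u v _ <-. Qed.

Lemma contring_prodE I (s : seq I) (F : I -> contring X) x :
  (\prod_(i <- s) F i) x = \prod_(i <- s) F i x.
Proof. by elim/big_rec2: _ => // i u v _ <-. Qed.

Lemma contring_cst (c : K) : exists s : contring X, forall x, s x = c.
Proof. by apply: contring_intro => [a|]; [exact: cont_at_cst|exact: gdef_cst]. Qed.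

Lemma contring_bump a (r : K) : r != 0 -> exists t : contring X,
  [/\ (forall x, O (t x)),
      (forall x, ~ oball (val a) r (val x) -> near_at x (fun y => t y = 0)) &
      near_at a (fun x => t x = 1)].
Proof.
(* With the smaller radius [r'] the bump vanishes near each point [x] outside the ball of radius
   [r], not only at [x]: a point within [r'] of both [x] and [a] would put [x] into that ball. *)
move=> /abslt_split[r' r'0 [_ Hr]].
have [beta [bC bO [d d0 b1] b0 bdef]] := flat_bump K.
have /boolp.choice[F HF] : forall i : 'I_m, exists s : contring X,
    forall x, s x = beta ((val x i - val a i) * r'^-1).
  move=> i; apply: contring_intro => [b|].
    apply: cont_at_comp; first by move=> e e0; apply: bC.
    apply: cont_at_mul; last exact: cont_at_cst.
    apply: cont_at_sub; last exact: cont_at_cst.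
    by move=> e e0; exists e.
  apply: gdef_comp; first by move=> I j k; apply: bdef.
  by apply: gdef_mul; [apply: gdef_sub; [exact: gdef_coord|]|]; apply: gdef_cst.
exists (\prod_i F i); split.
- move=> x; rewrite contring_prodE; elim/big_rec: _ => [|i u _ Ou]; first exact: ovring1.
  by apply: ovringM; rewrite // HF.
- move=> x xr; exists r' => // y yx; rewrite contring_prodE.
  have /existsNP[i hi] : ~ oball (val a) r' (val y).
    move=> ya; apply: xr => i; have [_] := Hr _ _ (ya i) (yx i).
    by have -> : val y i - val a i - (val y i - val x i) = val x i - val a i by ring.
  by rewrite (bigD1 i) //= HF b0 ?mul0r // abslt_div2r // mul1r.
exists (d * r'); first by rewrite mulf_neq0.
move=> x xr; rewrite contring_prodE big1 // => i _; rewrite HF b1 //.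
by rewrite abslt_div2r //; apply: xr.
Qed.

(** At a zero of [t] the convention s / 0 = 0 agrees with the nearby values, because [s] is zero on
    a whole neighborhood; a mere zero of [s] at that point would not be enough. *)
Lemma contring_div (s t : contring X) :
  (forall x, t x = 0 -> near_at x (fun y => s y = 0)) ->
  exists q : contring X, forall x, q x = s x / t x.
Proof.
move=> H; apply: contring_intro => [a|].
  have [ta|ta] := eqVneq (t a) 0.
    apply: (@cont_at_near_eq _ (fun=> 0)); last exact: cont_at_cst.
    by apply: near_at_mono (H a ta) _ => x ->; rewrite mul0r.
  by apply: cont_at_mul; [|apply: cont_at_inv => //]; apply: contring_cont.
by apply: gdef_mul; [|apply: gdef_inv]; apply: contring_gdef.
Qed.

Definition coprime_in (R : pzRingType) (s t : R) : Prop := exists u v, u * s + v * t = 1.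

(** For the converse, a cut-off [c] equal to 1 near the zeros of [s] and to 0 near the zeros of [t]
    makes (1 - c) / s and c / t continuous. The usual denominator s^2 + t^2 could vanish when -1 is
    a square in K. *)
Lemma coprime_contring (s t : contring X) :
  coprime_in s t <-> forall x, s x = 0 -> t x != 0.
Proof.
split=> [[u [v uv]] x sx|st].
  have := congr1 (fun w : contring X => w x) uv.
  rewrite !contringE sx mulr0 add0r => h; apply: contra_eq_neq h => ->.
  by rewrite mulr0 eq_sym oner_neq0.
have [beta [bC bO [d d0 b1] b0 bdef]] := flat_bump K.
(* The factor [t x * (t x)^-1] makes [chi] vanish on the zeros of t, where the
   quotient [s x * (t x)^-1] takes the junk value 0. *)
have [chi] : exists chi : X -> K, chi = fun x => beta (s x * (t x)^-1) * (t x * (t x)^-1).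
  by eexists.
move=> chiE.
have chi_near0 a : t a = 0 -> near_at a (fun x => chi x = 0).
  move=> ta; have sa : s a != 0 by apply: contra_eq_neq ta => /st.
  have [r r0 Hr] := near_at_absge (contring_cont s a) sa.
  have := contring_cont t a r0; rewrite ta => Ht.
  apply: near_at_mono (near_at_and Hr Ht) _ => x [rs]; rewrite subr0 => tr.
  rewrite chiE; have [->|tx] := eqVneq (t x) 0; first by rewrite mul0r mulr0.
  rewrite b0 ?mul0r // abslt_div2r // mul1r => stx.
  by have := abslt_trans (abslt_le_trans tr rs) stx; apply: absltxx.
have quot_near a : t a != 0 -> cont_at (fun x => (t x)^-1) a.
  by apply: cont_at_inv; apply: contring_cont.
have cchi a : cont_at chi a.
  have [ta|ta] := eqVneq (t a) 0.
    by apply: (cont_at_near_eq (chi_near0 a ta)); apply: cont_at_cst.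
  rewrite chiE; apply: cont_at_mul; [apply: cont_at_comp|].
  - by move=> e e0; apply: bC.
  - by apply: cont_at_mul; [apply: contring_cont|apply: quot_near].
  - by apply: cont_at_mul; [apply: contring_cont|apply: quot_near].
have gchi : gdef chi.
  rewrite chiE; apply: gdef_mul; [apply: gdef_comp|].
  - by move=> I i j; apply: bdef.
  - by apply: gdef_mul; [|apply: gdef_inv]; apply: contring_gdef.
  - by apply: gdef_mul; [|apply: gdef_inv]; apply: contring_gdef.
have [c cE] := contring_intro cchi gchi.
have [v vE] : exists v : contring X, forall x, v x = c x / t x.
  by apply: contring_div => a /chi_near0 h; apply: near_at_mono h _ => x <-.
have [u uE] : exists u : contring X, forall x, u x = (1 - c) x / s x.
  apply: contring_div => a sa; have ta := st a sa.
  have cq : cont_at (fun x => s x * (t x)^-1) a.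
    by apply: cont_at_mul; [apply: contring_cont|apply: quot_near].
  have := near_at_and (cq d d0) (near_at_neq0 (contring_cont t a) ta).
  move=> h; apply: near_at_mono h _ => x; rewrite sa mul0r subr0 => -[/b1 h tx].
  by rewrite !contringE cE chiE h divff // mulr1 subrr.
exists u, v; apply: contring_ext => x; rewrite !contringE uE vE !contringE.
have [tx|tx] := eqVneq (t x) 0.
  have sx : s x != 0 by apply: contra_eq_neq tx => /st.
  by rewrite tx mulr0 addr0 cE chiE tx mul0r mulr0 subr0 divfK.
rewrite (divfK tx); have [sx|sx] := eqVneq (s x) 0.
  rewrite sx mulr0 add0r cE chiE sx mul0r divff // mulr1 b1 //.
  exact: abslt0.
by rewrite divfK // subrK.
Qed.
End ContinuousFunctions.

(** * The relation N *)

(** The witness [k] marks points: it shares a zero with [s], and at each zero of [k] the function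
    [G] is nonzero and [F = b * G]. A comparison at one point thus becomes a global identity modulo
    [k], with |b| < 1 everywhere. *)
Definition somewhere_lt (R : pzRingType) (B : set R) (s G F : R) : Prop :=
  exists k b c, [/\ ~ coprime_in k s, coprime_in k G, F = b * G + c * k &
    forall a, B a -> exists v, (1 - a * b) * v = 1].

Section SomewhereLess.
Variables (K : ovfield) (L : language) (S : structure L K) (m : nat).
Variable X : defset S m.
Implicit Types (s F G : contring X).

(* Near a point with |F| < |G| the quotient F / G is cut off by a bump to a
   function b with values in the open unit disk; conversely, 1 - a b being a
   unit for all constants a in O forces |b| < 1 at every point. *)
Lemma somewhere_ltP s G F : somewhere_lt (@ovalued K L S m X) s G F <->
  exists x : X, s x = 0 /\ abslt (F x) (G x).
Proof.
split=> [[k [b [c [ks kG FE bB]]]]|[x [sx FG]]].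
  have [x [kx sx]] : exists x : X, k x = 0 /\ s x = 0.
    apply: contrapT => nx; apply: ks; apply/coprime_contring => x kx.
    by apply/eqP => sx; apply: nx; exists x.
  move/coprime_contring: kG => /(_ x kx) Gx; exists x; split=> //.
  have -> : F x = b x * G x by rewrite FE !contringE kx mulr0 addr0.
  rewrite -[X in abslt _ X]mul1r abslt_pmul2r //; apply/abslt_below1.
  have [bx|bx] := eqVneq (b x) 0; first by left.
  right=> Ob; have [a aE] := contring_cst X (b x)^-1.
  have [v /(congr1 (fun w : contring X => w x))] := bB a (fun y => eq_ind_r _ Ob (aE y)).
  rewrite !contringE aE mulVf // subrr mul0r => /esym/eqP.
  by rewrite (negPf (oner_neq0 K)).
have Gx := abslt_neq0 FG.
have Q1 : abslt (F x / G x) 1 by rewrite abslt_div2r // mul1r.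
have [d d0 Hd] := abslt_ball_center Q1.
have cq : cont_at (fun y => F y / G y) x.
  by apply: cont_at_mul; [|apply: cont_at_inv => //]; apply: contring_cont.
have [r r0 Hr] := near_at_and (cq d d0) (near_at_neq0 (contring_cont G x) Gx).
have [t [tO t0 t1]] := contring_bump x r0.
have tout y : ~ oball (val x) r (val y) -> t y = 0 by move=> /t0/near_at_self.
have tG y : G y = 0 -> near_at y (fun z => t z = 0).
  by move=> Gy; apply: t0 => /Hr[_]; rewrite Gy eqxx.
have [b bE] : exists b : contring X, forall y, b y = (t * F) y / G y.
  apply: contring_div => y /tG h; apply: near_at_mono h _ => z.
  by rewrite contringE => ->; rewrite mul0r.
have b1 y : abslt (b y) 1.
  rewrite bE contringE; have [/Hr[h Gy]|/tout ->] := pselect (oball (val x) r (val y)).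
    apply: absle_lt_trans (Hd _ h); rewrite -mulrA -[X in absle _ X]mul1r.
    by apply: absleM; [apply/ovring_absle|exact: abslexx].
  by rewrite !mul0r; apply: abslt0; exact: oner_neq0.
(* As b = t F / G, the remainder F - b G is F (1 - t), a multiple of [k = 1 - t]. The zeros of [k]
   lie where t = 1, inside the ball on which [G] has no zero. *)
exists (1 - t), b, F; split.
- move=> /coprime_contring/(_ x); rewrite !contringE (near_at_self t1) subrr sx eqxx.
  by move=> /(_ erefl).
- apply/coprime_contring => y; rewrite !contringE => /eqP; rewrite subr_eq0 => /eqP ty.
  have [/Hr[]//|/tout] := pselect (oball (val x) r (val y)).
  by rewrite -ty => /eqP; rewrite oner_eq0.
- apply: contring_ext => y; rewrite !contringE bE contringE.
  have [/Hr[_ Gy]|/tout ->] := pselect (oball (val x) r (val y)).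
    by rewrite (divfK Gy); ring.
  by ring.
move=> a aB; have nz y : (1 - a * b) y != 0.
  rewrite !contringE; apply/eqP => /eqP; rewrite subr_eq0 => /eqP ab.
  have by0 : b y != 0 by apply: contra_eq_neq ab => ->; rewrite mulr0 oner_neq0.
  move/abslt_below1: (b1 y) => [/eqP|]; first by rewrite (negPf by0).
  by apply; rewrite -[_^-1]mul1r ab mulfK.
have [v vE] : exists v : contring X, forall y, v y = (1 : contring X) y / (1 - a * b) y.
  by apply: contring_div => y /eqP; rewrite (negPf (nz y)).
exists v; apply: contring_ext => y; rewrite contringE vE mulrCA divff //.
by rewrite mulr1.
Qed.

End SomewhereLess.

Lemma dpred_coprime_in (R : pzRingType) (B : set R) (P : Type) (c : P -> R)
  (I : Type) (s t : (I -> R) -> R) :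
  let SR := ring_pred_structure B in dterm SR c s -> dterm SR c t ->
  dpred SR c (fun x => coprime_in (s x) (t x)).
Proof.
move=> SR Hs Ht; do 2!apply: dpred_ex.
apply: dpred_eq; last exact: dterm_rone.
by apply: dterm_radd; apply: dterm_rmul;
  solve [exact: dterm_var|exact: (dterm_reindex (Some \o Some))].
Qed.

Lemma dpred_somewhere_lt (R : pzRingType) (B : set R) (P : Type) (c : P -> R)
  (I : Type) (s G F : (I -> R) -> R) :
  let SR := ring_pred_structure B in
  dterm SR c s -> dterm SR c G -> dterm SR c F ->
  dpred SR c (fun x => somewhere_lt B (s x) (G x) (F x)).
Proof.
move=> SR Hs HG HF.
apply: (@dpred_ext _ _ _ _ _ _ (fun x => exists k b d,
   (~ coprime_in k (s x)) /\ (coprime_in k (G x)) /\ (F x = b * G x + d * k) /\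
   (forall a, B a -> exists v, (1 - a * b) * v = 1))); last first.
  by move=> x; split=> [[k [b [d [h1 [h2 [h3 h4]]]]]]|[k [b [d [h1 h2 h3 h4]]]]]; exists k, b, d.
do 3!apply: dpred_ex.
have v3 t : dterm SR c t -> dterm SR c (fun y : option (option (option I)) -> R =>
    t (y \o Some \o Some \o Some)).
  move=> Ht; exact: (dterm_reindex (Some \o Some \o Some) Ht).
apply: dpred_and; [apply: dpred_not|apply: dpred_and; [|apply: dpred_and]].
- by apply: dpred_coprime_in; [exact: dterm_var|exact: v3].
- by apply: dpred_coprime_in; [exact: dterm_var|exact: v3].
- apply: dpred_eq; first exact: v3.
  by apply: dterm_radd; apply: dterm_rmul; solve [exact: dterm_var|exact: v3].
apply: dpred_all; apply: dpred_imp; first by apply: dpred_rpred; exact: dterm_var.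
apply: dpred_ex; apply: dpred_eq; last exact: dterm_rone.
apply: dterm_rmul; last exact: dterm_var.
apply: dterm_rsub; [exact: dterm_rone|apply: dterm_rmul; exact: dterm_var].
Qed.

(** * Cluster sets *)

Section PointFormulas.
Variables (R : pzRingType) (B : set R) (p : R).

Definition nonzero_at (u : R) : Prop := somewhere_lt B p u 0.

Definition equal_at (g h : R) : Prop := ~ somewhere_lt B p (g - h) 0.

(** The function [u] is tolerance and neighborhood at once: if it contains a bump as a factor, it
    vanishes away from the base point, and there the strict inequality fails. The denominator of f /
    p is cleared. *)
Definition cluster_at (s f h : R) : Prop :=
  forall u, nonzero_at u -> somewhere_lt B s (u * p) (f - h * p).

Definition bounded_cluster (s f : R) : Prop :=
  exists c, forall h, cluster_at s f h -> ~ somewhere_lt B p h c.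

Definition discrete_cluster (s f : R) : Prop :=
  forall h, cluster_at s f h -> exists r, nonzero_at r /\
    forall g, cluster_at s f g -> somewhere_lt B p r (g - h) -> equal_at g h.

Definition power_at (g h : R) : Prop := exists s f,
  bounded_cluster s f /\ discrete_cluster s f /\ cluster_at s f 1 /\
  forall a, cluster_at s f a -> equal_at a h \/ cluster_at s f (g * a).

End PointFormulas.

Section ClusterSet.
Variables (K : ovfield) (L : language) (S : structure L K) (m : nat).
Variables (X : defset S m) (p0 : X) (p : contring X).
Hypothesis p_zero : forall x : X, p x = 0 <-> x = p0.
Local Notation B := (@ovalued K L S m X).
Implicit Types (s f g h u : contring X) (x : X).

(** Strictness forces [p x] to be nonzero, hence [x <> p0]: the limits of f / p are taken along
    zeros of [s] other than [p0]. *)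
Definition cluster_set s f : set K :=
  [set a | forall e, e != 0 -> exists x, [/\ s x = 0,
     oball (val p0) e (val x) & abslt (f x - a * p x) (e * p x)]].

Lemma somewhere_lt_p0 g h : somewhere_lt B p g h <-> abslt (h p0) (g p0).
Proof.
rewrite somewhere_ltP; split=> [[x [/p_zero -> //]]|H].
by exists p0; split=> //; apply/p_zero.
Qed.

Lemma nonzero_atP u : nonzero_at B p u <-> u p0 != 0.
Proof. by rewrite /nonzero_at somewhere_lt_p0 abslt_0l. Qed.

Lemma equal_atP g h : equal_at B p g h <-> g p0 = h p0.
Proof.
rewrite /equal_at somewhere_lt_p0 abslt_0l !contringE subr_eq0.
by split=> [/negP/negPn/eqP|->]; rewrite ?eqxx.
Qed.

(** The formula has h(x) where the set has h(p0); by continuity of [h] the difference is below any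
    given tolerance near [p0]. *)
Lemma cluster_atP s f h : cluster_at B p s f h <-> cluster_set s f (h p0).
Proof.
split=> [H e e0|H u /nonzero_atP u0].
  have [r r0 [re Hr]] := abslt_split e0.
  have [q q0 Hq] : near_at p0 (fun x => abslt (h x - h p0) r /\ oball (val p0) e (val x)).
    by apply: near_at_and; [apply: contring_cont|exists e].
  have [t [tO t0 t1]] := contring_bump p0 q0.
  have [c cE] := contring_cst X r.
  (* Tested on the constant [r] times a bump at [p0], the formula yields a point with [t x] nonzero,
     hence close to [p0]. *)
  have /H/somewhere_ltP[x [sx]] : nonzero_at B p (c * t).
    by apply/nonzero_atP; rewrite contringE cE (near_at_self t1) mulr1.
  rewrite !contringE cE => fx; have := abslt_neq0 fx.
  rewrite !mulf_eq0 !negb_or => /andP[/andP[_ tx] px].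
  have [|hx ex] := Hq x.
    by apply: contrapT => /t0/near_at_self/eqP; rewrite (negPf tx).
  exists x; split=> //; rewrite -abslt_div2r //.
  have -> : (f x - h p0 * p x) / p x = (f x - h x * p x) / p x + (h x - h p0).
    by field; rewrite px.
  apply: (Hr _ _ _ hx).1; rewrite abslt_div2r //; apply: abslt_le_trans fx _.
  apply: absleM; last exact: abslexx.
  by rewrite -[X in absle _ X]mulr1; apply: absleM; [exact: abslexx|apply/ovring_absle].
have [c c0 uc] := near_at_absge (contring_cont u p0) u0.
have [r r0 [_ Hr]] := abslt_split c0.
have [q q0 Hq] := near_at_and uc (contring_cont h p0 r0).
have [e e0 He] := abslt_min q0 r0.
apply/somewhere_ltP; have [x [sx xe fx]] := H e e0; exists x; split=> //.
have px : p x != 0 by have := abslt_neq0 fx; rewrite mulf_eq0 negb_or => /andP[].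
have [ux hx] : absle c (u x) /\ abslt (h x - h p0) r.
  by apply: Hq => i; have [] := He _ (xe i).
rewrite !contringE -abslt_div2r //.
have -> : (f x - h x * p x) / p x = (f x - h p0 * p x) / p x - (h x - h p0).
  by field; rewrite px.
apply: abslt_le_trans ux; apply: (Hr _ _ _ hx).2.
by move: fx; rewrite -abslt_div2r // => /He[].
Qed.

Lemma closed_cluster_set s f : closed_in_field (cluster_set s f).
Proof.
move=> a /existsNP[e /not_implyP[e0 He]].
have [r r0 [re Hr]] := abslt_split e0; exists r => // b ba bs.
apply: He; have [x [sx xr fx]] := bs r r0; exists x; split=> //.
  by move=> i; apply: abslt_le_trans re.
have px : p x != 0 by have := abslt_neq0 fx; rewrite mulf_eq0 negb_or => /andP[].
rewrite -abslt_div2r //.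
have -> : (f x - a * p x) / p x = (f x - b * p x) / p x + (b - a) by field; rewrite px.
by apply: (Hr _ _ _ ba).1; rewrite abslt_div2r.
Qed.

Lemma definable_cluster_set s f : definable_in_field S (cluster_set s f).
Proof.
apply: dpred_definable.
(* The variables [o], [v], [w] hold the values of [s], [f], [p] at the point [z]; they are read off
   the graphs, which are definable. *)
apply: (@dpred_ext _ _ _ _ _ _ (fun y : 'I_1 -> K => forall e, ~ e = 0 ->
  exists z : 'I_m -> K, exists o, exists v, exists w,
  [/\ graph s (econs o z), graph f (econs v z) & graph p (econs w z)] /\
  (o = 0 /\ (forall i, abslt (z i - val p0 i) e) /\
  abslt (v - y ord0 * w) (e * w)))); last first.
  move=> y; split=> H e e0.
    have [|z [o [v [w [[[x xz sx] [x' xz' fx] [x'' xz'' px]] [o0 [ze]]]]]]] := H e.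
      exact/eqP.
    have xx' : x' = x by apply/val_inj; rewrite xz xz'.
    have xx'' : x'' = x by apply/val_inj; rewrite xz xz''.
    move: sx fx px => /= sx fx px.
    rewrite -px -fx xx' xx'' => h; exists x; split=> //; first by rewrite sx.
    by move=> i; rewrite xz; apply: ze.
  have [|x [sx xe fx]] := H e; first exact/eqP.
  by exists (val x), 0, (f x), (p x); split; [split; exists x|].
apply: dpred_all; apply: dpred_imp.
  by apply: dpred_not; apply: dpred_eq; [apply: dterm_var|apply: dterm_const].
apply: dpred_ex_ord; do 3!apply: dpred_ex.
pose hh (T : Type) (u : T) (k : 'I_m -> T) (j : option 'I_m) := if j is Some i then k i else u.
have gr (t : contring X) T (u : T) (k : 'I_m -> T) :
    dpred (expansion S) id (fun z : T -> K => graph t (econs (z u) (z \o k))).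
  apply: (dpred_ext (dpred_reindex (hh T u k) (dpred_of_definable (contring_gdef t)))) => z.
  suff -> : z \o hh T u k = econs (z u) (z \o k) by [].
  by apply/funext => -[].
apply: dpred_and.
  apply: (@dpred_ext _ _ _ _ _ _ (fun z : option (option (option (option 'I_1 + 'I_m))) -> K =>
    graph s (econs (z (Some (Some None))) (z \o (Some \o Some \o Some \o inr))) /\
    graph f (econs (z (Some None)) (z \o (Some \o Some \o Some \o inr))) /\
    graph p (econs (z None) (z \o (Some \o Some \o Some \o inr))))).
    by do 2?apply: dpred_and; apply: gr.
  by move=> z; split=> [[? []]|[]].
apply: dpred_and; first by apply: dpred_eq; [apply: dterm_var|apply: dterm_const].
apply: dpred_and.
  apply: dpred_forall_ord => i.
  by apply: dpred_abslt; [apply: dterm_sub|]; solve [apply: dterm_var|apply: dterm_const].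
apply: dpred_abslt; last by apply: dterm_mul; apply: dterm_var.
by apply: dterm_sub; [|apply: dterm_mul]; apply: dterm_var.
Qed.

Hypothesis finite_discrete : forall A : set K,
  definable_in_field S A -> closed_in_field A -> bounded_in_field A ->
  discrete_in_field A -> finite_set A.

(** Every element of K is the value at [p0] of a constant function, so the two formulas, which
    quantify over functions, do bound the cluster set and make it discrete in K. *)
Lemma finite_cluster_set s f :
  bounded_cluster B p s f -> discrete_cluster B p s f -> finite_set (cluster_set s f).
Proof.
move=> [c Hc] Hd; apply: finite_discrete.
- exact: definable_cluster_set.
- exact: closed_cluster_set.
- exists (c p0) => a Ha; have [h hE] := contring_cst X a.
  have /Hc : cluster_at B p s f h by apply/cluster_atP; rewrite hE.
  by rewrite somewhere_lt_p0 hE => /absleNgt.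
move=> a Ha; have [h hE] := contring_cst X a.
have /Hd[r [/nonzero_atP r0 Hr]] : cluster_at B p s f h by apply/cluster_atP; rewrite hE.
exists (r p0) => // b Hb; have [g gE] := contring_cst X b.
have /Hr : cluster_at B p s f g by apply/cluster_atP; rewrite gE.
by rewrite somewhere_lt_p0 equal_atP !contringE hE gE.
Qed.

Lemma bounded_discrete_cluster s f :
  bounded_in_field (cluster_set s f) -> discrete_in_field (cluster_set s f) ->
  bounded_cluster B p s f /\ discrete_cluster B p s f.
Proof.
move=> [c Hc] Hd; split.
  have [g gE] := contring_cst X c; exists g => h /cluster_atP/Hc.
  by rewrite somewhere_lt_p0 gE => /absleNgt.
move=> h /cluster_atP/Hd[r r0 Hr]; have [u uE] := contring_cst X r.
exists u; split; first by apply/nonzero_atP; rewrite uE.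
by move=> g /cluster_atP/Hr; rewrite somewhere_lt_p0 equal_atP !contringE uE.
Qed.

End ClusterSet.

Lemma abslt_lower_bound (K : ovfield) n (w : 'I_n -> K) : (forall i, w i != 0) ->
  exists2 e : K, e != 0 & forall i, ~ abslt (w i) e.
Proof.
move=> w0; suff [e e0 He] : exists2 e : K, e != 0 &
    forall i, i \in enum 'I_n -> ~ abslt (w i) e.
  by exists e => // i; apply: He; rewrite mem_enum.
elim: (enum _) => [|i s [e e0 IH]]; first by exists 1; rewrite ?oner_neq0.
have [t t0 Ht] := abslt_min e0 (w0 i); exists t => // j.
by rewrite inE => /orP[/eqP ->|/IH nj] /Ht[h1 h2] //; apply: absltxx h2.
Qed.

(** * Realizing finite cluster sets by germs *)

Section ExtensionByZero.
Variables (K : ovfield) (L : language) (S : structure L K) (m : nat).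
Variables (X : defset S m) (V : set ('I_m -> K)).

(** In general this is discontinuous at the frontier of [V]. It will be multiplied by a bump, and
    also by [p] when [V] omits [p0]. *)
Definition extend0 (g : V -> K) (z : 'I_m -> K) : K :=
  if pselect (V z) is left h then g (SigSub (mem_set h)) else 0.

Lemma extend0E g (z : V) : extend0 g (val z) = g z.
Proof.
rewrite /extend0; case: pselect => [h|]; last by case; apply: set_valP.
by congr g; apply: val_inj.
Qed.

Lemma extend0_out g z : ~ V z -> extend0 g z = 0.
Proof. by rewrite /extend0; case: pselect. Qed.

Lemma gdef_extend0 g : definable (expansion S) V -> definable (expansion S) (graph g) ->
  gdef (fun x : X => extend0 g (val x)).
Proof.
move=> /dpred_of_definable defV /dpred_of_definable defg.
apply: (@gdef_restr _ _ _ _ _ (fun v z => graph g (econs v z) \/ (~ V z /\ v = 0))).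
  apply: dpred_or.
    apply: (dpred_ext defg) => z; suff -> : z = econs (z None) (z \o Some) by [].
    by apply/funext => -[].
  apply: dpred_and; last by apply: dpred_eq; [apply: dterm_var|apply: dterm_const].
  by apply: dpred_not; exact: (dpred_reindex Some defV).
move=> x v; split=> [[[y yx /= <-]|[nV ->]]|<-].
- by rewrite -extend0E yx.
- by rewrite extend0_out.
have [Vx|nV] := pselect (V (val x)); last by right; rewrite extend0_out.
by left; exists (SigSub (mem_set Vx)); rewrite //= -extend0E.
Qed.

Lemma cont_at_extend0 g (a : X) : continuous_on g -> near_at a (fun x => V (val x)) ->
  cont_at (fun x : X => extend0 g (val x)) a.
Proof.
move=> cg nV e e0; have Va := near_at_self nV.
have [r r0 H] := cg (SigSub (mem_set Va)) e e0.
have nr : near_at a (fun x => oball (val a) r (val x)) by exists r.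
apply: near_at_mono (near_at_and nV nr) _ => x [Vx xr].
have := H (SigSub (mem_set Vx)) xr.
by rewrite -!extend0E.
Qed.

End ExtensionByZero.

Section Germs.
Variables (K : ovfield) (L : language) (S : structure L K) (m : nat).
Variables (X : defset S m) (p0 : X) (p : contring X).
Hypothesis p_zero : forall x : X, p x = 0 <-> x = p0.
Hypothesis germs : arbitrarily_many_germs S X (val p0).

(** With [s] the product of the t s_i and [f] the sum of the v_i p t delta_i, the zeros of [s] near
    [p0] other than [p0] are the points of the germs, and f / p is v_i on the i-th one. Zeros
    introduced by the bump [t] stay away from [p0]. At least two germs are taken because (S3) gives
    the value 1 of delta_i on its own germ only in presence of some j <> i. *)
Lemma cluster_set_realize n (v : 'I_n.+2 -> K) :
  exists s f : contring X, cluster_set p0 p s f = range v.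
Proof.
have [U [si [[defU UX Up0 [r r0 HrU]] csi]]] := germs (ltn0Sn n.+1).
move=> [delta [cdelta disj vanish sep bdd]].
have defU' : definable (expansion S) (U `\ val p0).
  apply: dpred_definable; apply: dpred_and; first exact: dpred_of_definable.
  apply: dpred_not.
  apply: (@dpred_ext _ _ _ _ _ _ (fun z : 'I_m -> K => forall i, z i = val p0 i)).
    by apply: dpred_forall_ord => i; apply: dpred_eq; [apply: dterm_var|apply: dterm_const].
  by move=> z; split=> [h|->//]; apply/funext.
have [r1 r10 [r1r Hr1]] := abslt_split r0.
have [t [tO t0 t1]] := contring_bump p0 r10.
have ballU x : oball (val p0) r1 (val x) -> near_at x (fun y : X => U (val y)).
  move=> xr; exists r1 => // y yx; apply: HrU; split; first exact: set_valP.
  move=> i; have [h _] := Hr1 _ _ (yx i) (xr i).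
  by have <- : val y i - val x i + (val x i - val p0 i) = val y i - val p0 i by ring.
have near_neq x : x <> p0 -> near_at x (fun y : X => y <> p0).
  move=> xp; have px : p x != 0 by apply/eqP => /p_zero.
  by apply: near_at_mono (near_at_neq0 (contring_cont p x) px) _ => y /eqP py /p_zero.
have /boolp.choice[Si SiE] : forall i, exists g : contring X,
    forall x, g x = t x * extend0 (si i) (val x).
  move=> i; have [ci di] := csi i; apply: contring_intro => [x|]; last first.
    by apply: gdef_mul; [apply: contring_gdef|apply: gdef_extend0].
  have [xr|xr] := pselect (oball (val p0) r1 (val x)).
    apply: cont_at_mul; first exact: contring_cont.
    by apply: cont_at_extend0 => //; apply: ballU.
  apply: (@cont_at_near_eq _ _ _ _ _ _ (fun=> 0)); last exact: cont_at_cst.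
  by apply: near_at_mono (t0 _ xr) _ => y ->; rewrite mul0r.
have /boolp.choice[C HC] : forall i, exists c : K, c != 0 /\
    forall z, absle (extend0 (delta i) z) c.
  move=> i; have [c Hc] := bdd i.
  have Hc' z : absle (extend0 (delta i) z) c.
    rewrite /extend0; case: pselect => [h|_]; first by apply: Hc; eexists.
    by apply/absleNgt => /abslt_neq0/eqP.
  (* The bound 0 is replaced by 1, because [e / C i] will serve as a nonzero tolerance for [p]. *)
  have [c0|c0] := eqVneq c 0; last by exists c.
  exists 1; split; first exact: oner_neq0.
  by move=> z; apply: (absle_trans (Hc' z)); rewrite c0; apply/absleNgt => /abslt_neq0/eqP.
have /boolp.choice[Fi FiE] : forall i, exists g : contring X,
    forall x, g x = p x * t x * extend0 (delta i) (val x).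
  move=> i; have [ci di] := cdelta i; have [C0 Ci] := HC i.
  apply: contring_intro => [x|]; last first.
    by apply: gdef_mul; [apply: gdef_mul; apply: contring_gdef|apply: gdef_extend0].
  (* At [p0] continuity follows from |p t delta_i| <= |p| |C_i|, as [p] tends to 0. *)
  have [->|/eqP xp] := eqVneq x p0.
    move=> e e0; have pp0 : p p0 = 0 by apply/p_zero.
    have eC : e / C i != 0 by rewrite mulf_neq0 ?invr_eq0.
    apply: near_at_mono (contring_cont p p0 eC) _ => y.
    rewrite pp0 !mul0r !subr0 => py.
    have {}py : abslt (p y * C i) e by rewrite -(divfK C0 e) abslt_pmul2r.
    apply: absle_lt_trans py; apply: absleM => //.
    by rewrite -[X in absle _ X]mulr1; apply: absleM; [exact: abslexx|apply/ovring_absle].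
  have [xr|xr] := pselect (oball (val p0) r1 (val x)).
    apply: cont_at_mul; first by apply: cont_at_mul; exact: contring_cont.
    apply: cont_at_extend0 => //.
    apply: near_at_mono (near_at_and (ballU x xr) (near_neq x xp)) _ => y [Uy yp].
    by split=> // h; apply: yp; apply: val_inj.
  apply: (@cont_at_near_eq _ _ _ _ _ _ (fun=> 0)); last exact: cont_at_cst.
  by apply: near_at_mono (t0 _ xr) _ => y ->; rewrite mulr0 mul0r.
have /boolp.choice[V VE] := fun i => contring_cst X (v i).
pose s := \prod_i Si i; pose f := \sum_i V i * Fi i.
have [q q0 Hq] := near_at_and t1 (ballU p0 (oball_center _ r10)).
have germ_val x i : oball (val p0) q (val x) -> x <> p0 ->
    zeroset (si i) (val x) -> s x = 0 /\ f x = v i * p x.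
  move=> /Hq[tx Ux] xp Zi.
  have Ux' : (U `\ val p0) (val x) by split=> // h; apply: xp; apply: val_inj.
  split.
    rewrite contring_prodE (bigD1 i) //= SiE; case: Zi => y <- yi.
    by rewrite extend0E yi mulr0 mul0r.
  have dE j : extend0 (delta j) (val x) = (j == i)%:R.
    rewrite -[val x]/(val (SigSub (mem_set Ux') : (U `\ val p0))) extend0E.
    have [->|ji] := eqVneq j i.
      pose j' : 'I_n.+2 := if i == ord0 then ord_max else ord0.
      have ij' : i != j' by rewrite /j'; case: ifP => [/eqP ->|->].
      by apply: (sep _ _ ij' _).1; split=> // h; apply: xp; apply: val_inj.
    by apply: (sep _ _ ji _).2; split=> // h; apply: xp; apply: val_inj.
  have VFE j : (V j * Fi j) x = v j * (p x * (j == i)%:R).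
    by rewrite contringE VE FiE dE tx mulr1.
  rewrite contring_sumE (eq_bigr _ (fun j _ => VFE j)) (bigD1 i) //= eqxx mulr1.
  by rewrite big1 ?addr0 // => j /negPf ->; rewrite !mulr0.
exists s, f; apply/seteqP; split=> [a Ha|_ [i _ <-]].
  (* If [a] is none of the [v i], all |v_i - a| are at least some nonzero |e|; but on the i-th germ
     |f - a p| = |v_i - a| |p|. *)
  apply: contrapT => na.
  have [i|e e0 He] := @abslt_lower_bound K _ (fun i => v i - a).
    by apply/eqP => /subr0_eq h; apply: na; exists i.
  have [d d0 Hd] := abslt_min e0 q0.
  have [x [sx xd fx]] := Ha d d0.
  have px : p x != 0 by have := abslt_neq0 fx; rewrite mulf_eq0 negb_or => /andP[].
  have xq : oball (val p0) q (val x) by move=> i; have [] := Hd _ (xd i).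
  have xp : x <> p0 by move/p_zero; apply/eqP.
  have [tx Ux] := Hq x xq.
  have [i Zi] : exists i, zeroset (si i) (val x).
    move/eqP: sx; rewrite contring_prodE prodf_seq_eq0 => /hasP[i _ /= /eqP].
    rewrite SiE tx mul1r => h; exists i; exists (SigSub (mem_set Ux)) => //.
    by rewrite -extend0E.
  have [_ fE] := germ_val x i xq xp Zi.
  move: fx; rewrite fE -mulrBl abslt_pmul2r // => /Hd[h _].
  exact: He h.
(* Conversely, [p0] is not isolated among the zeros of [si i], so each ball contains another zero,
   at which f - v_i p is 0. *)
move=> e e0; have [d d0 Hd] := abslt_min e0 q0.
have [Zp0 niso] := vanish i.
have [z [Zz zd zp]] : exists z, [/\ zeroset (si i) z, oball (val p0) d z & z <> val p0].
  apply: contrapT => nz; apply: niso; split=> //; exists d => //.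
  apply/seteqP; split=> [z [Zz zd]|_ ->]; last by split=> //; apply: oball_center.
  by apply: contrapT => zp; apply: nz; exists z.
have Xz : (X : set _) z by case: Zz => y <- _; apply: UX; apply: set_valP.
pose x : X := SigSub (mem_set Xz).
have [|||sx fx] := germ_val x i.
- by move=> j; have [] := Hd _ (zd j).
- by move=> xp; apply: zp; rewrite -xp.
- by [].
exists x; split=> //; first by move=> j; have [] := Hd _ (zd j).
rewrite fx subrr; apply: abslt0; rewrite mulf_neq0 //.
by apply/eqP => /p_zero xp; apply: zp; rewrite -xp.
Qed.

End Germs.

(** * Powers and integer arithmetic *)

Section Powers.
Variable K : ovfield.
Variable z : K.
Hypotheses (z0 : z != 0) (z1 : abslt z 1).

Lemma absle_expr1 n : absle (z ^+ n) 1.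
Proof.
elim: n => [|n IH]; first by rewrite expr0; exact: abslexx.
by rewrite exprS -[X in absle _ X]mulr1; apply: absleM => //; case: z1.
Qed.

Lemma expr_eq1_eq0 n : z ^+ n = 1 -> n = 0%N.
Proof.
case: n => // n; rewrite exprS => h.
have : abslt (z * z ^+ n) 1.
  apply: absle_lt_trans z1; rewrite -[X in absle _ X]mulr1.
  by apply: absleM; [exact: abslexx|exact: absle_expr1].
by rewrite h => /absltxx.
Qed.

(** An element with 0 < |z| < 1 is no root of unity. This makes the integer represented by a
    function unique. *)
Lemma exprz_inj (i j : int) : z ^ i = z ^ j -> i = j.
Proof.
have key (k : int) : z ^ k = 1 -> k = 0.
  case: (intP k) => // n; first by rewrite -exprnP => /expr_eq1_eq0.
  by rewrite -invr_expz => /(congr1 (@GRing.inv K)); rewrite invrK invr1 => /expr_eq1_eq0.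
move=> ij; apply/eqP; rewrite -subr_eq0; apply/eqP/key.
by rewrite expfzDr // ij -expfzDr // subrr expr0z.
Qed.

Lemma expr_inj (i j : nat) : z ^+ i = z ^+ j -> i = j.
Proof. by rewrite !exprnP => /exprz_inj[]. Qed.

End Powers.

Section PowerAt.
Variables (K : ovfield) (L : language) (S : structure L K) (m : nat).
Variables (X : defset S m) (p0 : X) (p : contring X).
Hypothesis p_zero : forall x : X, p x = 0 <-> x = p0.
Hypothesis finite_discrete : forall A : set K,
  definable_in_field S A -> closed_in_field A -> bounded_in_field A ->
  discrete_in_field A -> finite_set A.
Hypothesis germs : arbitrarily_many_germs S X (val p0).
Local Notation B := (@ovalued K L S m X).
Implicit Types g h : contring X.

(* If h(p0) is not a power of g(p0), then a cluster set as in [power_at]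
   contains all the powers of g(p0), so it is infinite. *)
Lemma power_atP g h : g p0 != 0 -> abslt (g p0) 1 ->
  power_at B p g h <-> exists n : nat, h p0 = g p0 ^+ n.
Proof.
move=> g0 g1; split=> [[s [f [bd [disc [c1 cS]]]]]|[n hn]].
  apply: contrapT => nh.
  have fin := finite_cluster_set p_zero finite_discrete bd disc.
  have pow n : cluster_set p0 p s f (g p0 ^+ n).
    elim: n => [|n IH]; first by rewrite expr0; move/(cluster_atP p_zero): c1.
    have [a aE] := contring_cst X (g p0 ^+ n).
    have /cS[/(equal_atP p_zero) ah|/(cluster_atP p_zero)] : cluster_at B p s f a.
      by apply/(cluster_atP p_zero); rewrite aE.
      by case: nh; exists n; rewrite -ah aE.
    by rewrite contringE aE exprS.
  apply: infinite_nat.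
  have -> : [set: nat] = (fun n => g p0 ^+ n) @^-1` cluster_set p0 p s f.
    by apply/seteqP; split=> k // _; apply: pow.
  by apply: finite_preimage fin => i j _ _; apply: expr_inj.
(* The set 1, g, ..., g^n has n + 1 listed elements; the last one is repeated because the
   realization takes n + 2 values, so that n = 0 is covered. *)
pose v (i : 'I_n.+2) := g p0 ^+ minn i n.
have [s [f sfv]] := cluster_set_realize p_zero germs v.
have bd : bounded_in_field (cluster_set p0 p s f).
  by exists 1; rewrite sfv => _ [i _ <-]; apply: absle_expr1.
have disc : discrete_in_field (cluster_set p0 p s f).
  (* Indices with [v i = a] receive the nonzero placeholder 1, so that a common lower bound
     exists. *)
  rewrite sfv => a _; pose w i := if v i == a then 1 else v i - a.
  have [i|e e0 He] := @abslt_lower_bound K _ w.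
    by rewrite /w; case: ifP => [_|/negbT va]; [exact: oner_neq0|rewrite subr_eq0].
  exists e => // _ [i _ <-] vie; apply: contrapT => /eqP va.
  by apply: (He i); rewrite /w (negPf va).
have [bd' disc'] := bounded_discrete_cluster p_zero bd disc.
exists s, f; split=> //; split=> //; split.
  by apply/(cluster_atP p_zero); rewrite sfv contring1E; exists ord0; rewrite /v ?min0n.
move=> a /(cluster_atP p_zero); rewrite sfv => -[i _ vi].
have [ni|ni] := leqP n i.
  by left; apply/(equal_atP p_zero); rewrite -vi hn /v (minn_idPr ni).
right; apply/(cluster_atP p_zero); rewrite sfv contringE -vi.
have i2 : (i.+1 < n.+2)%N by rewrite !ltnS ltnW.
by exists (Ordinal i2); rewrite // /v /= (minn_idPl ni) (minn_idPl (ltnW ni)) exprS.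
Qed.

End PowerAt.

(** * Addition, divisibility and multiplication of exponents *)

Section IntegerFormulas.
Variables (R : pzRingType) (B : set R) (p t : R).

Definition natpow_at (h : R) : Prop := power_at B p t h.

Definition intpow_at (h : R) : Prop :=
  natpow_at h \/ exists g, equal_at B p (h * g) 1 /\ natpow_at g.

(* On exponents: w = x ^ 2, expressed through a = |x| and the fact that
   w + a = a (a + 1) is the least common multiple of a and a + 1. *)
Definition square_at (x w : R) : Prop := exists a, natpow_at a /\
  (equal_at B p a x \/ equal_at B p (a * x) 1) /\
  ((equal_at B p a 1 /\ equal_at B p w 1) \/
   (~ equal_at B p a 1 /\
    power_at B p a (w * a) /\ power_at B p (a * t) (w * a) /\
    ~ equal_at B p (w * a) 1 /\
    forall y, power_at B p a y -> power_at B p (a * t) y ->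
      power_at B p (w * a) y)).

(* The polarization (i + j)^2 = i^2 + j^2 + 2 i j. *)
Definition product_at (x y z : R) : Prop := exists u v w,
  square_at x u /\ square_at y v /\ square_at (x * y) w /\ equal_at B p w (u * v * (z * z)).

End IntegerFormulas.

Section Integers.
Variables (K : ovfield) (L : language) (S : structure L K) (m : nat).
Variables (X : defset S m) (p0 : X) (p t : contring X).
Hypothesis p_zero : forall x : X, p x = 0 <-> x = p0.
Hypothesis finite_discrete : forall A : set K,
  definable_in_field S A -> closed_in_field A -> bounded_in_field A ->
  discrete_in_field A -> finite_set A.
Hypothesis germs : arbitrarily_many_germs S X (val p0).
Hypotheses (t0 : t p0 != 0) (t1 : abslt (t p0) 1).
Local Notation B := (@ovalued K L S m X).
Local Notation tau := (t p0).
Implicit Types (g h x y z w : contring X) (i j : int).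

Lemma natpow_atP h : natpow_at B p t h <-> exists n : nat, h p0 = tau ^+ n.
Proof. exact: power_atP. Qed.

Lemma intpow_atP h : intpow_at B p t h <-> exists i, h p0 = tau ^ i.
Proof.
split=> [[/natpow_atP[n hn]|[g [/(equal_atP p_zero) gh /natpow_atP[n gn]]]]|[i hi]].
- by exists n%:Z; rewrite -exprnP.
- exists (- n%:Z); rewrite -invr_expz -exprnP -gn.
  move: gh; rewrite contringE contring1E => gh; have g0 : g p0 != 0.
    by apply: contra_eq_neq gh => ->; rewrite mulr0 eq_sym oner_neq0.
  by apply: (mulIf g0); rewrite gh mulVf.
case: (intP i) hi => [|n|n] hi.
- by left; apply/natpow_atP; exists 0%N; rewrite hi.
- by left; apply/natpow_atP; exists n.+1; rewrite hi.
right; have [g gE] := contring_cst X (tau ^+ n.+1); exists g; split.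
  apply/(equal_atP p_zero); rewrite contringE gE hi contring1E -invr_expz -exprnP.
  by rewrite mulVf // expf_neq0.
by apply/natpow_atP; exists n.+1; rewrite gE.
Qed.

(** The exponent is a successor because [power_atP] requires |g(p0)| < 1, which fails for exponent
    0. This is why [square_at] treats the case where [a] has value 1 apart. *)
Lemma divides_atP g h (n : nat) : g p0 = tau ^+ n.+1 ->
  power_at B p g h <-> exists c : nat, h p0 = tau ^+ (n.+1 * c).
Proof.
move=> gn; rewrite power_atP // gn; last 2 first.
- by rewrite expf_neq0.
- rewrite exprS; apply: absle_lt_trans t1; rewrite -[X in absle _ X]mulr1.
  by apply: absleM; [exact: abslexx|exact: absle_expr1].
by split=> -[c hc]; exists c; rewrite hc exprM.
Qed.

Lemma equal_at1P h i : h p0 = tau ^ i -> equal_at B p h 1 <-> i = 0.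
Proof.
move=> hi; rewrite (equal_atP p_zero) hi contring1E; split=> [h1|->]; last by rewrite expr0z.
by apply: (exprz_inj t0 t1); rewrite h1 expr0z.
Qed.

(** Consecutive integers are coprime, so their common multiples are the multiples of their
    product. *)
Lemma lcmn_succ_unique (n Q : nat) : (0 < n)%N -> (0 < Q)%N ->
  (n %| Q)%N -> (n.+1 %| Q)%N -> (Q %| n * n.+1)%N -> Q = (n * n.+1)%N.
Proof.
move=> n0 Q0 h1 h2 h3; apply/eqP; rewrite eqn_dvd h3 /= Gauss_dvd ?h1 //.
exact: coprimenS.
Qed.

Lemma square_atP x w i : x p0 = tau ^ i ->
  square_at B p t x w <-> w p0 = tau ^ (i * i).
Proof.
move=> xi; split.
  move=> [a [/natpow_atP[n an] [ax H]]].
  have ni : n%:Z * n%:Z = i * i.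
    case: ax => /(equal_atP p_zero).
      by rewrite an xi exprnP => /(exprz_inj t0 t1) ->.
    rewrite contringE an xi contring1E exprnP -expfzDr // -(expr0z tau).
    by move=> /(exprz_inj t0 t1)/eqP; rewrite addr_eq0 => /eqP ->; rewrite mulrNN.
  have an' : a p0 = tau ^ n%:Z by rewrite an exprnP.
  rewrite -ni; case: H => [[/(equal_at1P an')]|].
    by move=> [->] /(equal_atP p_zero) ->; rewrite contring1E mul0r expr0z.
  move=> [a1 [aw [atw [w1 wl]]]].
  case: n an an' ni a1 => [|n] an an' ni a1; first by case: a1; apply/(equal_at1P an').
  have atn : (a * t) p0 = tau ^+ n.+2 by rewrite contringE an [RHS]exprSr.
  have [c wc] := (divides_atP (w * a) an).1 aw.
  have [d wd] := (divides_atP (w * a) atn).1 atw.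
  have cd : (n.+1 * c = n.+2 * d)%N by apply: (expr_inj t0 t1); rewrite -wc -wd.
  (* The exponent 0 is a common multiple too; the clause that [w * a] does not have value 1 excludes
     it. *)
  have Q0 : (0 < n.+1 * c)%N.
    rewrite lt0n; apply/eqP => Q0; apply: w1; apply/(equal_atP p_zero).
    by rewrite wc Q0 expr0 contring1E.
  (* Minimality is tested on the product of the two exponents, which the exponent of [w * a] must
     then divide. *)
  have [y yE] := contring_cst X (tau ^+ (n.+1 * n.+2)).
  have wQ : (w * a) p0 = tau ^+ (n.+1 * c).-1.+1 by rewrite prednK.
  have /(divides_atP _ wQ)[e] : power_at B p (w * a) y.
    apply: wl; first by apply/(divides_atP _ an); exists n.+2; rewrite yE.
    by apply/(divides_atP _ atn); exists n.+1; rewrite yE mulnC.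
  rewrite yE prednK // => /(expr_inj t0 t1) ye.
  have QE : (n.+1 * c = n.+1 * n.+2)%N.
    apply: lcmn_succ_unique => //; first exact: dvdn_mulr.
      by rewrite cd dvdn_mulr.
    by rewrite ye dvdn_mulr.
  have a0 : a p0 != 0 by rewrite an expf_neq0.
  apply: (mulIf a0); rewrite -contringME wc QE an -!exprnP -exprD.
  by congr (_ ^+ _); rewrite mulnS addnC.
move=> wi; have [a aE] := contring_cst X (tau ^+ `|i|%N); exists a.
have ai : a p0 = tau ^ (`|i|%N : int) by rewrite aE exprnP.
split; [by apply/natpow_atP; exists `|i|%N|split].
  case: (intP i) aE xi => [|n|n] aE xi.
  - by left; apply/(equal_atP p_zero); rewrite aE xi.
  - by left; apply/(equal_atP p_zero); rewrite aE xi exprnP.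
  right; apply/(equal_atP p_zero); rewrite contringE aE xi contring1E abszN absz_nat.
  by rewrite -invr_expz -exprnP divff // expf_neq0.
have wa : (w * a) p0 = tau ^+ (`|i| * `|i|.+1)%N.
  rewrite contringE wi aE mulnS exprD mulrC; congr (_ * _).
  by rewrite exprnP; congr (tau ^ _); lia.
case iE: (`|i|%N) ai wa aE => [|n] ai wa aE.
  left; split; apply/(equal_atP p_zero); first by rewrite aE expr0.
  have i0 : i = 0 by apply/eqP; rewrite -absz_eq0 iE.
  by rewrite wi i0 mul0r expr0z contring1E.
have an : a p0 = tau ^+ n.+1 by rewrite aE.
have atn : (a * t) p0 = tau ^+ n.+2 by rewrite contringE an [RHS]exprSr.
right; split; first by move/(equal_at1P ai).
split; first by apply/(divides_atP _ an); exists n.+2.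
split; first by apply/(divides_atP _ atn); exists n.+1; rewrite wa mulnC.
have wa' : (w * a) p0 = tau ^ (n.+1 * n.+2)%N%:Z by rewrite wa exprnP.
split; first by move/(equal_at1P wa').
move=> y /(divides_atP _ an)[c yc] /(divides_atP _ atn)[d yd].
have cd : (n.+1 * c = n.+2 * d)%N by apply: (expr_inj t0 t1); rewrite -yc -yd.
have /dvdnP[e ce] : (n.+1 * n.+2 %| n.+1 * c)%N.
  by rewrite Gauss_dvd ?coprimenS // dvdn_mulr // cd dvdn_mulr.
have wQ : (w * a) p0 = tau ^+ (n.+1 * n.+2).-1.+1 by rewrite prednK.
by apply/(divides_atP _ wQ); exists e; rewrite prednK // yc ce mulnC.
Qed.

Lemma product_atP x y z i j k : x p0 = tau ^ i -> y p0 = tau ^ j -> z p0 = tau ^ k ->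
  product_at B p t x y z <-> k = i * j.
Proof.
move=> xi yj zk; have xy : (x * y) p0 = tau ^ (i + j) by rewrite contringE xi yj expfzDr.
have cst (l : int) : exists u : contring X, u p0 = tau ^ l.
  by have [u uE] := contring_cst X (tau ^ l); exists u.
split.
  move=> [u [v [w [/(square_atP _ xi) ui [/(square_atP _ yj) vj [/(square_atP _ xy) wij]]]]]].
  move/(equal_atP p_zero); rewrite !contringE ui vj wij zk -!expfzDr //.
  (* The exponents satisfy (i + j)^2 = i^2 + j^2 + 2k, and 2 cancels in the integers. *)
  by move=> /(exprz_inj t0 t1); lia.
move=> kE; have [u uE] := cst (i * i); have [v vE] := cst (j * j).
have [w wE] := cst ((i + j) * (i + j)); exists u, v, w.
split; first exact/(square_atP _ xi).
split; first exact/(square_atP _ yj).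
split; first exact/(square_atP _ xy).
apply/(equal_atP p_zero); rewrite !contringE uE vE wE zk -!expfzDr //.
by congr (tau ^ _); rewrite kE; ring.
Qed.

End Integers.

(** * First-order definability of the formulas *)

Section FormulaDefinability.
Variables (R : pzRingType) (B : set R) (P : Type) (c : P -> R) (p t : R).
Local Notation SR := (ring_pred_structure B).
Hypothesis p_term : forall I, dterm SR c (fun _ : I -> R => p).
Hypothesis t_term : forall I, dterm SR c (fun _ : I -> R => t).

Let shift2 I (u : (I -> R) -> R) : dterm SR c u ->
  dterm SR c (fun y : option (option I) -> R => u (y \o (Some \o Some))).
Proof. exact: dterm_reindex. Qed.

Let shift3 I (u : (I -> R) -> R) : dterm SR c u ->
  dterm SR c (fun y : option (option (option I)) -> R => u (y \o (Some \o Some \o Some))).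
Proof. exact: dterm_reindex. Qed.

Ltac solve_dterm :=
  do ?[apply: dterm_rmul|apply: dterm_rsub];
  solve [exact: dterm_rone|exact: dterm_var|exact: p_term|exact: t_term|assumption
        |exact: (dterm_reindex Some)|exact: shift2|exact: shift3].

Lemma dpred_nonzero_at I (u : (I -> R) -> R) : dterm SR c u ->
  dpred SR c (fun x => nonzero_at B p (u x)).
Proof.
(* The constant 0 is produced as the term [p - p]. *)
move=> Hu; apply: (@dpred_ext _ _ _ _ _ _ (fun x => somewhere_lt B p (u x) (p - p))).
  by apply: dpred_somewhere_lt; solve_dterm.
by move=> x; rewrite subrr.
Qed.

Lemma dpred_equal_at I (g h : (I -> R) -> R) : dterm SR c g -> dterm SR c h ->
  dpred SR c (fun x => equal_at B p (g x) (h x)).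
Proof.
move=> Hg Hh; apply: (@dpred_ext _ _ _ _ _ _
  (fun x => ~ somewhere_lt B p (g x - h x) (p - p))).
  by apply: dpred_not; apply: dpred_somewhere_lt; solve_dterm.
by move=> x; rewrite subrr.
Qed.

Lemma dpred_cluster_at I (s f h : (I -> R) -> R) :
  dterm SR c s -> dterm SR c f -> dterm SR c h ->
  dpred SR c (fun x => cluster_at B p (s x) (f x) (h x)).
Proof.
move=> Hs Hf Hh; apply: dpred_all; apply: dpred_imp.
  by apply: dpred_nonzero_at; solve_dterm.
by apply: dpred_somewhere_lt; solve_dterm.
Qed.

Lemma dpred_power_at I (g h : (I -> R) -> R) : dterm SR c g -> dterm SR c h ->
  dpred SR c (fun x => power_at B p (g x) (h x)).
Proof.
move=> Hg Hh; do 2!apply: dpred_ex; apply: dpred_and; [|apply: dpred_and; [|apply: dpred_and]].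
- apply: dpred_ex; apply: dpred_all; apply: dpred_imp.
    by apply: dpred_cluster_at; solve_dterm.
  by apply: dpred_not; apply: dpred_somewhere_lt; solve_dterm.
- apply: dpred_all; apply: dpred_imp; first by apply: dpred_cluster_at; solve_dterm.
  apply: dpred_ex; apply: dpred_and; first by apply: dpred_nonzero_at; solve_dterm.
  apply: dpred_all; apply: dpred_imp; first by apply: dpred_cluster_at; solve_dterm.
  apply: dpred_imp; first by apply: dpred_somewhere_lt; solve_dterm.
  by apply: dpred_equal_at; solve_dterm.
- by apply: dpred_cluster_at; solve_dterm.
apply: dpred_all; apply: dpred_imp; first by apply: dpred_cluster_at; solve_dterm.
apply: dpred_or; first by apply: dpred_equal_at; solve_dterm.
by apply: dpred_cluster_at; solve_dterm.
Qed.

Lemma dpred_intpow_at I (h : (I -> R) -> R) : dterm SR c h ->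
  dpred SR c (fun x => intpow_at B p t (h x)).
Proof.
move=> Hh; apply: dpred_or; first by apply: dpred_power_at; solve_dterm.
apply: dpred_ex; apply: dpred_and; first by apply: dpred_equal_at; solve_dterm.
by apply: dpred_power_at; solve_dterm.
Qed.

Lemma dpred_square_at I (x w : (I -> R) -> R) : dterm SR c x -> dterm SR c w ->
  dpred SR c (fun y => square_at B p t (x y) (w y)).
Proof.
move=> Hx Hw; apply: dpred_ex; apply: dpred_and; first by apply: dpred_power_at; solve_dterm.
apply: dpred_and; first by apply: dpred_or; apply: dpred_equal_at; solve_dterm.
apply: dpred_or; first by apply: dpred_and; apply: dpred_equal_at; solve_dterm.
apply: dpred_and; first by apply: dpred_not; apply: dpred_equal_at; solve_dterm.
do 2!(apply: dpred_and; first by apply: dpred_power_at; solve_dterm).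
apply: dpred_and; first by apply: dpred_not; apply: dpred_equal_at; solve_dterm.
apply: dpred_all; do 2!(apply: dpred_imp; first by apply: dpred_power_at; solve_dterm).
by apply: dpred_power_at; solve_dterm.
Qed.

Lemma dpred_product_at I (x y z : (I -> R) -> R) :
  dterm SR c x -> dterm SR c y -> dterm SR c z ->
  dpred SR c (fun e => product_at B p t (x e) (y e) (z e)).
Proof.
move=> Hx Hy Hz; do 3!apply: dpred_ex.
do 3!(apply: dpred_and; first by apply: dpred_square_at; solve_dterm).
by apply: dpred_equal_at; solve_dterm.
Qed.

End FormulaDefinability.

(** * The interpretation, on one-tuples of functions *)

Theorem corollary5p6 (K : ovfield) (L : language) (S : structure L K)
  (closed_bounded_discrete_finite : forall A : set K,
     definable_in_field S A -> closed_in_field A -> bounded_in_field A ->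
     discrete_in_field A -> finite_set A)
  (tau : K) (tau_neq0 : tau != 0) (tau_lt1 : abslt tau 1)
  (m : nat) (X : defset S m) (p0 : X)
  (germs : arbitrarily_many_germs S X (val p0))
  (p taustar : contring X)
  (p_zero : forall x : X, p x = 0 <-> x = p0)
  (taustar_p0 : taustar p0 = tau) :
  interpretable (contring_structure X)
    (fun b : bool => if b then p else taustar) int_structure.
Proof.
have t0 : taustar p0 != 0 by rewrite taustar_p0.
have t1 : abslt (taustar p0) 1 by rewrite taustar_p0.
set par := fun b : bool => _; pose B := @ovalued K L S m X.
have p_term I : dterm (ring_pred_structure B) par (fun _ : I -> contring X => p).
  exact: (dterm_param _ par true).
have t_term I : dterm (ring_pred_structure B) par (fun _ : I -> contring X => taustar).
  exact: (dterm_param _ par false).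
pose D : set ('I_1 -> contring X) := [set x | intpow_at B p taustar (x ord0)].
have DP x : D x <-> exists i : int, x ord0 p0 = taustar p0 ^ i.
  exact: (intpow_atP p_zero closed_bounded_discrete_finite germs).
(* Outside [D] this takes the default value 0, but each relation to be defined includes membership
   in [D]. *)
pose pi (x : 'I_1 -> contring X) : int := xget 0 [set i : int | x ord0 p0 = taustar p0 ^ i].
have piE (x : 'I_1 -> contring X) (i : int) : x ord0 p0 = taustar p0 ^ i -> pi x = i.
  move=> xi; rewrite /pi; case: xgetP => [j _ /= xj|/(_ i)//].
  by apply: (exprz_inj t0 t1); rewrite -xj.
have piP (x : 'I_1 -> contring X) : D x -> x ord0 p0 = taustar p0 ^ pi x.
  by move=> /DP[i xi]; rewrite (piE x i xi).
have dD J (j : J) : dpred (ring_pred_structure B) par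
    (fun z : J * 'I_1 -> contring X => D (fun i => z (j, i))).
  by apply: dpred_intpow_at => //; apply: dterm_var.
exists 1%N, D, pi; split.
- by apply: dpred_definable; apply: dpred_intpow_at => //; apply: dterm_var.
- move=> i; have [h hE] := contring_cst X (taustar p0 ^ i).
  by exists (fun=> h); [apply/DP; exists i|apply: piE].
- apply: dpred_definable; apply: (dpred_ext (dpred_and (dD _ false) (dpred_and (dD _ true)
    (dpred_equal_at p_term (dterm_var _ _ (false, ord0)) (dterm_var _ _ (true, ord0)))))).
  move=> z; split=> [[/= h1 [h2 /(equal_atP p_zero) h3]]|[/= h1 h2 h3]].
    by split=> //; apply: piE; rewrite h3; apply: piP.
  split=> //; split=> //; apply/(equal_atP p_zero).
  by move: (piP _ h1) (piP _ h2) => /= -> ->; rewrite h3.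
- move=> f; pose i1 : 'I_2 := ord0; pose i2 : 'I_2 := ord_max.
  apply: dpred_definable.
  have vt (j : option 'I_2) := dterm_var (ring_pred_structure B) par (j, ord0 : 'I_1).
  pose Q (z : option 'I_2 * 'I_1 -> contring X) (j : option 'I_2) := z (j, ord0).
  pose graph_at : (option 'I_2 * 'I_1 -> contring X) -> Prop := fun z => match f with
    | ZAdd => equal_at B p (Q z None) (Q z (Some i1) * Q z (Some i2))
    | ZMul => product_at B p taustar (Q z (Some i1)) (Q z (Some i2)) (Q z None) end.
  have dG : dpred (ring_pred_structure B) par graph_at.
    rewrite /graph_at; case: f graph_at => _.
      exact: (dpred_equal_at p_term (vt _) (dterm_rmul (vt _) (vt _))).
    exact: (dpred_product_at p_term t_term (vt _) (vt _) (vt _)).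
  apply: (dpred_ext (dpred_and (dD _ None) (dpred_and (dD _ (Some i1))
    (dpred_and (dD _ (Some i2)) dG)))) => z.
  have E : (forall j, D (fun i => z (j, i))) <-> D (fun i => z (None, i)) /\
      D (fun i => z (Some i1, i)) /\ D (fun i => z (Some i2, i)).
    split=> [H|[h0 [h1 h2]] [j|//]]; first by do !split.
    case: (unliftP ord0 j) => [k|] ->; last exact: h1.
    by have -> : lift ord0 k = i2 by rewrite [k]ord1; apply: val_inj.
  suff G : (forall j, D (fun i => z (j, i))) -> (graph_at z <->
      pi (fun i => z (None, i)) = @ifun _ _ int_structure f (fun j => pi (fun i => z (Some j, i)))).
    split=> [[h0 [h1 [h2 g]]]|[/[dup] H /E[h0 [h1 h2]] /(G H) g]] //.
    have H := E.2 (conj h0 (conj h1 h2)).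
    by split=> //; apply/(G H).
  move=> H; have z0 := piP _ (H None); have z1 := piP _ (H (Some i1)).
  have z2 := piP _ (H (Some i2)); move: z0 z1 z2.
  rewrite /graph_at /Q; case: f graph_at dG => _ _ /= z0 z1 z2; last first.
    exact: (product_atP p_zero closed_bounded_discrete_finite germs t0 t1 z1 z2 z0).
  rewrite (equal_atP p_zero) contringME z0 z1 z2 -expfzDr //.
  by split=> [/(exprz_inj t0 t1)|->].
by case.
Qed.
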